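(* Let $\mathcal{H}$ denote either $\operatorname{Homeo}_0(\mathbf{T}^2)$ or $\operatorname{Homeo}_{0,\lambda}(\mathbf{T}^2)$ (the statement holds in both cases). Suppose that the rotation set of $f\in\mathcal{H}$ is $\epsilon$-upper-stable in $\mathcal{H}$ with $0<\epsilon<1$. Then $\rho_{\epsilon/2}(\tilde f)=\rho(\tilde f)$ for any lift $\tilde f$ of $f$. Moreover, for any lift $\tilde f$ and each $\epsilon/2$-pseudo-orbit $(\tilde x_i)_{i\in\mathbf{N}}$ of $\tilde f$ one has, for all $n\in\mathbf{N}$, $$d\big(\tilde x_n-\tilde x_0,\,n\rho(\tilde f)\big)\le\frac{16}{\pi\epsilon^2}\big(\operatorname{osc}(f)+2\big)+\epsilon.$$ If $(\tilde x_i)_{i\in\mathbf{N}}$ is an actual orbit of $\tilde f$ (i.e. $\tilde x_{i+1}=\tilde f(\tilde x_i)$), the bound can be replaced by $\frac{4}{\pi\epsilon^2}(\operatorname{osc}(f)+1)+\epsilon$.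
   Context: $\mathbf{T}^2=\mathbf{R}^2/\mathbf{Z}^2$; $\operatorname{Homeo}_0(\mathbf{T}^2)$ is the space of homeomorphisms of $\mathbf{T}^2$ isotopic to the identity, $\operatorname{Homeo}_{0,\lambda}(\mathbf{T}^2)$ its subspace of Lebesgue-area-preserving ones, both with the uniform distance $d_{C^0}$. For a lift $\tilde f$ of $f$ to $\mathbf{R}^2$, $\rho(\tilde f)$ is the set of all limits $\lim_k(\tilde f^{n_k}(z_k)-z_k)/n_k$ with $z_k\in\mathbf{R}^2$, $n_k\to\infty$; $\rho(f)$ is $\rho(\tilde f)$ modulo integer translations. $\rho(f)$ is $\epsilon$-upper-stable in $\mathcal{H}$ if every $g\in\mathcal{H}$ with $d_{C^0}(f,g)<\epsilon$ satisfies $\rho(g)\subset\rho(f)$ (modulo integer translations, i.e. the rotation set of the lift of $g$ closest to $\tilde f$ is contained in $\rho(\tilde f)$). An $\varepsilon$-pseudo-orbit of $\tilde f$ is a sequence $(x_i)$ in $\mathbf{R}^2$ with $\|\tilde f(x_i)-x_{i+1}\|<\varepsilon$ for all $i$. $\rho_\varepsilon(\tilde f)$ is the set of $v\in\mathbf{R}^2$ for which there are integers $n_k\to\infty$ and $\varepsilon$-pseudo-orbits $(x^k_i)_{0\le i\le n_k}$ of $\tilde f$ with $(x^k_{n_k}-x^k_0)/n_k\to v$. The oscillation of $f$ is $\operatorname{osc}(f)=\sup_{x,y\in\mathbf{R}^2}\|(\tilde f(x)-x)-(\tilde f(y)-y)\|$ for any lift $\tilde f$ (independent of the lift). $d(x,A)$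 is the Euclidean distance from a point to a set and $n\rho(\tilde f)=\{nv:v\in\rho(\tilde f)\}$. *)

(* Defs.v *)
From HB Require Import structures.
From mathcomp Require Import all_boot all_order all_algebra.
From mathcomp Require Import all_classical all_reals all_analysis.
Set Implicit Arguments. Unset Strict Implicit. Unset Printing Implicit Defensive.
Import Order.TTheory GRing.Theory Num.Theory.
Import numFieldNormedType.Exports.
Local Open Scope classical_set_scope.
Local Open Scope ring_scope.

(* Points of the plane R^2 are pairs (x, y) : R * R. A homeomorphism
   f in Homeo_0(T^2) is represented through its lift F : R^2 -> R^2. *)

Section Defs.
Variable R : realType.
Local Notation P := (R * R)%type.

Definition enorm (x : P) : R := Num.sqrt (x.1 ^+ 2 + x.2 ^+ 2).

Definition ztrans (p q : int) : P := (p%:~R, q%:~R).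

Definition homeo (F : P -> P) : Prop :=
  continuous F /\ exists G : P -> P, continuous G /\ cancel F G /\ cancel G F.

(* F is a lift of some f in Homeo_0(T^2): a homeomorphism of R^2 commuting
   with the integer translations. *)
Definition lift_homeo0 (F : P -> P) : Prop :=
  homeo F /\ forall (x : P) (p q : int), F (x + ztrans p q) = F x + ztrans p q.

Definition leb2 := ((@lebesgue_measure R) \x (@lebesgue_measure R))%E.

(* F preserves Lebesgue measure (equivalently f preserves area on T^2) *)
Definition area_preserving (F : P -> P) : Prop :=
  forall A : set P, measurable A -> leb2 (F @^-1` A) = leb2 A.

(* membership of (the lift F of) f in H: area = false gives Homeo_0(T^2),
   area = true gives Homeo_{0,lambda}(T^2). *)
Definition in_H (area : bool) (F : P -> P) : Prop :=
  lift_homeo0 F /\ (area -> area_preserving F).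

Definition dC0 (F G : P -> P) : R := sup [set enorm (F x - G x) | x in [set: P]].

Definition tends_to_infty (n : nat -> nat) : Prop :=
  forall M : nat, exists K : nat, forall k : nat, (K <= k)%N -> (M <= n k)%N.

Definition rot_set (F : P -> P) : set P :=
  [set v | exists (z : nat -> P) (n : nat -> nat), tends_to_infty n /\
     (fun k => (n k)%:R^-1 *: (iter (n k) F (z k) - z k)) @ \oo --> v].

Definition pseudo_orbit (F : P -> P) (e : R) (x : nat -> P) (n : nat) : Prop :=
  forall i : nat, (i < n)%N -> enorm (F (x i) - x i.+1) < e.

Definition rot_set_eps (F : P -> P) (e : R) : set P :=
  [set v | exists (x : nat -> nat -> P) (n : nat -> nat), tends_to_infty n /\
     (forall k, pseudo_orbit F e (x k) (n k)) /\
     (fun k => (n k)%:R^-1 *: (x k (n k) - x k 0%N)) @ \oo --> v].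

Definition osc (F : P -> P) : R :=
  sup [set r | exists x y : P, r = enorm ((F x - x) - (F y - y))].

Definition dist_set (v : P) (A : set P) : R := inf [set enorm (v - a) | a in A].

Definition scale_set (n : nat) (A : set P) : set P := [set n%:R *: a | a in A].

(* epsilon-upper-stability of the rotation set in H (distance measured between
   F and the lift G of g closest to F) *)
Definition upper_stable (area : bool) (F : P -> P) (eps : R) : Prop :=
  forall G : P -> P, in_H area G -> dC0 F G < eps -> rot_set G `<=` rot_set F.

End Defs.

(* Main.v *)
Require Import Defs.
From HB Require Import structures.
From mathcomp Require Import all_boot all_order all_algebra.
From mathcomp Require Import all_classical all_reals all_analysis.
From mathcomp Require Import measurable_realfun.
From mathcomp Require Import ring lra zify.
Set Implicit Arguments. Unset Strict Implicit. Unset Printing Implicit Defensive.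
Import Order.TTheory GRing.Theory Num.Theory.
Import numFieldNormedType.Exports.
Local Open Scope classical_set_scope.
Local Open Scope ring_scope.

(** A pseudo-orbit with jumps smaller than [e < eps] becomes an orbit of some [G]
   with [dC0 F G < eps].  Take [G = h \o F], where [h] is a composition of shears
   [z |-> z + phi (cross v z) *: v] of the torus along integer vectors [v]: these
   preserve area, and if the directions are close to the sides of a regular polygon
   inscribed in the circle of radius [e], the total displacement of any point stays
   below [eps] while every vector of norm at most [e] can be prescribed.  A single
   [G] follows all paths of a finite grid of points at once: bi-infinite paths are
   embedded in the plane as a Cantor set in general position with respect to the
   shears, and Tietze's theorem extends the prescribed displacements.  Hence
   [rot_set_eps F e] is contained in [rot_set G], thus in [rot_set F].

   For the bounds, cut an orbit at its last visits near (mod Z^2) a point [y_1],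
   then near the next point [y_2], etc.  The [y_k] are separated mod Z^2, so disc
   packing bounds their number.  Running [m] times around each loop and letting [m]
   grow gives one vector [V] of [rot_set_eps F e], thus of [rot_set F], with
   [x_n - x_0 - n V] controlled by the few steps outside the loops. *)

(** * Area-preserving shears *)

(** Stability concerns one homeomorphism at a time, whereas a vector of [rot_set_eps] comes from
    infinitely many pseudo-orbits of unbounded length. Hence [G] must be chosen before them, which a
    finite alphabet of grid points and integer translations makes possible. Paths are two-sided
    because [G] is injective: the shift that it realizes must be invertible. General position is
    forced by the shears, which see a point only through [cross v] modulo 1 and move together all
    points sharing this value. Adding up the lengths of the shears would lose a factor close to pi/2
    in the displacement; the vector sums of signed half edges of a polygon, however, never leave the
    polygon. The polygon shears reach their goal only approximately, so two small shears along the
    axes finish the move exactly. In the estimates [d0] bounds the jumps, [c] is the gap closed by a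
    loop, and [d0 + c < eps] is needed. So [c] approaches [eps / 2] for pseudo-orbits and [eps] for
    orbits, whence the factors 16 and 4; the additive [eps] pays for the strict inequality. *)

Section area.
Variable R : realType.
Local Notation P := (R * R)%type.
Local Notation mu := (@lebesgue_measure R).

Lemma lebesgue_measure_translation (c : R) (A : set R) : measurable A ->
  mu ((fun y : R => y + c) @^-1` A) = mu A.
Proof.
move=> mA.
have mc : measurable_fun setT ((fun y => y + c) : R -> measurableTypeR R).
  by apply: measurable_funD.
change (pushforward mu ((fun y => y + c) : R -> measurableTypeR R) A = mu A).
apply/esym/(@lebesgue_measure_unique R
  (pushforward mu ((fun y => y + c) : R -> measurableTypeR R))) => //.
move=> /= _ [[a b]] _ <-.
rewrite /pushforward /=.
have -> : (fun y => y + c) @^-1` `]a, b] = `](a - c), (b - c)]%classic.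
  by apply/seteqP; split=> y /=; rewrite !in_itv/= ltrBlDr lerBrDr.
rewrite !lebesgue_measure_itv/= !lte_fin ltrD2r; case: ifP => // _.
by congr (_%:E); ring.
Qed.

Definition vshear (f : R -> R) (z : P) : P := (z.1, z.2 + f z.1).
Definition hshear (f : R -> R) (z : P) : P := (z.1 + f z.2, z.2).

Lemma measurable_vshear f : measurable_fun setT f ->
  measurable_fun setT (vshear f).
Proof.
move=> mf; apply/measurable_fun_pairP; split => //=.
- exact: measurable_fst.
- by apply: measurable_funD => //; apply: measurableT_comp.
Qed.

Lemma measurable_hshear f : measurable_fun setT f ->
  measurable_fun setT (hshear f).
Proof.
move=> mf; apply/measurable_fun_pairP; split => //=.
- by apply: measurable_funD => //; apply: measurableT_comp.
- exact: measurable_snd.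
Qed.

Lemma leb2_vshear f (A : set P) : measurable_fun setT f -> measurable A ->
  leb2 (vshear f @^-1` A) = leb2 A.
Proof.
move=> mf mA; rewrite /leb2 /product_measure1; apply: eq_integral => x _ /=.
rewrite -[RHS](lebesgue_measure_translation (f x)); last exact: measurable_xsection.
by congr (mu _); apply/seteqP; split=> y; rewrite /xsection /= !inE.
Qed.

Lemma leb2_hshear f (A : set P) : measurable_fun setT f -> measurable A ->
  leb2 (hshear f @^-1` A) = leb2 A.
Proof.
move=> mf mA.
(* [leb2] integrates the measures of vertical sections, while [hshear f] translates horizontal ones;
   uniqueness of the product measure allows integration in the other order. *)
have swapE (B : set P) : measurable B ->
    leb2 B = (\int[mu]_y (mu \o ysection B) y)%E.
  move=> mB; rewrite /leb2.
  pose m2 := product_measure2 mu mu.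
  apply: (@product_measure_unique _ _ _ _ R mu mu m2) => // C D mC mD.
  exact: product_measure2E.
have mS : measurable (hshear f @^-1` A).
  by rewrite -[_ @^-1` _]setTI; apply: measurable_hshear.
rewrite !swapE//; apply: eq_integral => y _ /=.
rewrite -[RHS](lebesgue_measure_translation (f y)); last exact: measurable_ysection.
by congr (mu _); apply/seteqP; split=> x; rewrite /ysection /= !inE.
Qed.

End area.

(** * Shears along integer vectors *)

Section torus_shears.
Variable R : realType.
Local Notation P := (R * R)%type.

Lemma scale_pairE (a : R) (z : P) : a *: z = (a * z.1, a * z.2).
Proof. by case: z. Qed.

Lemma continuous_pair (X U V : topologicalType) (f : X -> U) (g : X -> V) :
  continuous f -> continuous g -> continuous (fun x => (f x, g x)).
Proof. by move=> cf cg x; apply: cvg_pair; [exact: cf | exact: cg]. Qed.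

Lemma continuous_fst (U V : topologicalType) : continuous (@fst U V).
Proof. by move=> x; exact: cvg_fst. Qed.

Lemma continuous_snd (U V : topologicalType) : continuous (@snd U V).
Proof. by move=> x; exact: cvg_snd. Qed.

Lemma continuous_compT (X Y Z : topologicalType) (f : X -> Y) (g : Y -> Z) :
  continuous f -> continuous g -> continuous (fun x => g (f x)).
Proof. by move=> cf cg x; apply: continuous_comp; [exact: cf | exact: cg]. Qed.

Lemma continuous_addT (X : topologicalType) (V : normedModType R)
    (f g : X -> V) :
  continuous f -> continuous g -> continuous (fun x => f x + g x).
Proof. by move=> cf cg x; apply: cvgD; [exact: cf | exact: cg]. Qed.

Lemma continuous_subT (X : topologicalType) (V : normedModType R)
    (f g : X -> V) :
  continuous f -> continuous g -> continuous (fun x => f x - g x).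
Proof. by move=> cf cg x; apply: cvgB; [exact: cf | exact: cg]. Qed.

Lemma continuous_mulT (X : topologicalType) (f g : X -> R) :
  continuous f -> continuous g -> continuous (fun x => f x * g x).
Proof. by move=> cf cg x; apply: cvgM; [exact: cf | exact: cg]. Qed.

Lemma continuous_scaleT (X : topologicalType) (f : X -> R) (v : P) :
  continuous f -> continuous (fun x => f x *: v).
Proof. by move=> cf x; apply: cvgZ; [exact: cf | exact: cvg_cst]. Qed.

Definition cross (v z : P) : R := v.1 * z.2 - v.2 * z.1.

Lemma crossD v z z' : cross v (z + z') = cross v z + cross v z'.
Proof. by rewrite /cross /=; ring. Qed.

Lemma crossZ v a z : cross v (a *: z) = a * cross v z.
Proof. by rewrite scale_pairE /cross /=; ring. Qed.

Lemma crossvv v : cross v v = 0.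
Proof. by rewrite /cross mulrC subrr. Qed.

Lemma continuous_cross v : continuous (cross v).
Proof.
apply: continuous_subT; apply: continuous_mulT; try by move=> ?; exact: cvg_cst.
- exact: continuous_snd.
- exact: continuous_fst.
Qed.

Definition shear (v : P) (phi : R -> R) (z : P) : P := z + phi (cross v z) *: v.

Definition zperiodic (phi : R -> R) :=
  forall (r : R) (m : int), phi (r + m%:~R) = phi r.

(** Area is preserved in both cases of [area], so one construction serves both. Measurability is
    carried along because [area_preserving] concerns measurable sets only, and a composition needs
    measurable preimages. *)
Definition torus_area_map (h : P -> P) :=
  [/\ lift_homeo0 h, measurable_fun setT h & area_preserving h].

Lemma torus_area_map_id : torus_area_map id.
Proof.
split => //; split => //; split; first by move=> x; exact: cvg_id.
by exists id; split => // x; exact: cvg_id.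
Qed.

Lemma lift_homeo0_comp (f g : P -> P) :
  lift_homeo0 f -> lift_homeo0 g -> lift_homeo0 (f \o g).
Proof.
move=> [[cf [f' [cf' [ff' f'f]]]] fZ] [[cg [g' [cg' [gg' g'g]]]] gZ].
split; last by move=> x p q /=; rewrite gZ fZ.
split; first exact: continuous_compT.
exists (g' \o f'); split; first exact: continuous_compT.
by split=> x /=; rewrite ?ff' ?gg' ?g'g ?f'f.
Qed.

Lemma torus_area_map_comp (f g : P -> P) :
  torus_area_map f -> torus_area_map g -> torus_area_map (f \o g).
Proof.
move=> [lf mf af] [lg mg ag]; split; first exact: lift_homeo0_comp.
- exact: measurableT_comp.
- move=> A mA; rewrite comp_preimage ag ?af//.
  by rewrite -[_ @^-1` _]setTI; exact: mf.
Qed.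

Lemma area_preserving_shear v phi : continuous phi ->
  measurable_fun setT (shear v phi) /\ area_preserving (shear v phi).
Proof.
move=> cphi.
have mphi : measurable_fun setT phi by exact: continuous_measurable_fun.
have mlin (a : R) : measurable_fun setT (fun x : R => a * x).
  by apply: measurable_funM.
have [v10|v10] := eqVneq v.1 0.
  have E : shear v phi = vshear (fun x => v.2 * phi (- v.2 * x)).
    apply/funext => z; rewrite /shear /vshear scale_pairE /cross v10.
    by congr pair => /=; [ring | rewrite mul0r sub0r -mulNr; ring].
  have mf : measurable_fun setT (fun x => v.2 * phi (- v.2 * x)).
    by apply: measurable_funM => //; apply: (measurableT_comp mphi); exact: mlin.
  rewrite E; split; first exact: measurable_vshear.
  by move=> A mA; exact: leb2_vshear.
(* The vertical shear of slope [k] sends the horizontal direction to that of [v], so it conjugates a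
   horizontal shear to [shear v phi]. *)
pose k := v.2 / v.1.
have mf : measurable_fun setT (fun y => v.1 * phi (v.1 * y)).
  by apply: measurable_funM => //; apply: (measurableT_comp mphi); exact: mlin.
have E : shear v phi = vshear (fun x => k * x) \o
    (hshear (fun y => v.1 * phi (v.1 * y)) \o vshear (fun x => - k * x)).
  apply/funext => z; rewrite /shear /vshear /hshear scale_pairE /cross /=.
  have -> : v.1 * (z.2 + - k * z.1) = v.1 * z.2 - v.2 * z.1 by rewrite /k; field.
  congr pair => /=; first by ring.
  by rewrite /k; field.
have m1 := measurable_vshear (mlin (- k)).
have m2 := measurable_hshear mf.
have m3 := measurable_vshear (mlin k).
have pre (f : P -> P) (A : set P) : measurable_fun setT f -> measurable A ->
    measurable (f @^-1` A).
  by move=> mf' mA; rewrite -[_ @^-1` _]setTI; exact: mf'.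
rewrite E; split.
  by apply: measurableT_comp => //; exact: measurableT_comp.
move=> A mA; rewrite !comp_preimage.
rewrite leb2_vshear//; last by apply: (pre _ _ m2); exact: (pre _ _ m3).
rewrite leb2_hshear//; last exact: (pre _ _ m3).
by rewrite leb2_vshear.
Qed.

Lemma continuous_shear v phi : continuous phi -> continuous (shear v phi).
Proof.
move=> cphi; apply: (@continuous_addT P) => [|]; first by move=> x; exact: cvg_id.
apply: continuous_scaleT; apply: continuous_compT cphi.
exact: continuous_cross.
Qed.

(** For an integer vector [v], integer translations change [cross v] by integers, which the periodic
    [phi] does not notice. The shear preserves [cross v], so [- phi] gives its inverse. *)
Lemma torus_area_map_shear (p q : int) phi : continuous phi -> zperiodic phi ->
  torus_area_map (shear (ztrans R p q) phi).
Proof.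
move=> cphi pphi; set v := ztrans R p q.
have [mS aS] := area_preserving_shear v cphi; split => //.
have crossS f z : cross v (shear v f z) = cross v z.
  by rewrite /shear crossD crossZ crossvv mulr0 addr0.
split; last first.
  move=> x a b; rewrite /shear crossD.
  have -> : cross v (ztrans R a b) = (p * b - q * a)%:~R.
    by rewrite /cross /v /ztrans /= -!intrM -intrB.
  by rewrite pphi addrAC.
split; first exact: continuous_shear.
exists (shear v (fun r => - phi r)); split.
  by apply: continuous_shear => x; apply: cvgN; exact: cphi.
split=> z; rewrite {1}/shear crossS /shear scaleNr ?addrK//.
by rewrite subrK.
Qed.

End torus_shears.

(** * Chains of shears with prescribed displacements *)

Section shear_chains.
Variable R : realType.
Local Notation P := (R * R)%type.

Lemma cos_eq1_int (x : R) : cos x = 1 -> exists m : int, x = m%:~R * (pi *+ 2).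
Proof.
move=> cx; pose m := Num.floor (x / (pi *+ 2)); exists m.
have pi2 : 0 < pi *+ 2 :> R by rewrite pmulrn_rgt0 ?pi_gt0.
pose y := x - m%:~R * (pi *+ 2).
have y0 : 0 <= y.
  by rewrite subr_ge0 -ler_pdivlMr// floor_le.
have y2 : y < pi *+ 2.
  rewrite /y ltrBlDr (_ : _ + _ = (m%:~R + 1) * (pi *+ 2)); last by ring.
  by rewrite -ltr_pdivrMr// -intrD1 floorD1_gt.
have per (n : nat) (z : R) : cos (z + n%:R * (pi *+ 2)) = cos z.
  by rewrite mulr_natl (periodicn (@cosD2pi R)).
have cy : cos y = 1.
  rewrite -cx /y; case: (intP m) => [|n|n].
  - by rewrite mul0r subr0.
  - by rewrite -[LHS](per n.+1) subrK.
  - by rewrite mulrNz mulNr opprK (per n.+1).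
suff : y = 0 by move/eqP; rewrite subr_eq0 => /eqP.
have [ypi|ypi] := leP y pi.
  by apply: (@cos_inj R); rewrite ?in_itv/= ?y0 ?lexx ?pi_ge0 ?cos0.
have : pi *+ 2 - y = 0.
  apply: (@cos_inj R); rewrite ?in_itv/= ?lexx ?pi_ge0 ?cos0//.
    by rewrite subr_ge0 ltW//= lerBlDr mulr2n lerD2l ltW.
  rewrite cosB cos2pi sin2pi mul1r mul0r addr0//.
by move/eqP; rewrite subr_eq0 => /eqP y2E; rewrite y2E ltxx in y2.
Qed.

Definition circle_pt (r : R) : P := (cos (pi *+ 2 * r), sin (pi *+ 2 * r)).

Lemma continuous_circle_pt : continuous circle_pt.
Proof.
have cl : continuous (fun r : R => pi *+ 2 * r).
  by apply: continuous_mulT => x; [exact: cvg_cst | exact: cvg_id].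
apply: continuous_pair; apply: (continuous_compT cl).
- exact: continuous_cos.
- exact: continuous_sin.
Qed.

Lemma circle_pt_periodic (r : R) (m : int) :
  circle_pt (r + m%:~R) = circle_pt r.
Proof.
have per (n : nat) (z : R) : circle_pt (z + n%:R) = circle_pt z.
  rewrite /circle_pt mulrDr [X in _ + X]mulrC mulr_natl.
  by rewrite (periodicn (@cosD2pi R)) (periodicn (@sinD2pi R)).
case: (intP m) => [|n|n]; first by rewrite addr0.
- exact: (per n.+1).
- by rewrite -[LHS](per n.+1) mulrNz subrK.
Qed.

Lemma circle_pt_eq (r s : R) : circle_pt r = circle_pt s ->
  exists m : int, r - s = m%:~R.
Proof.
move=> [cE sE].
have : cos (pi *+ 2 * r - pi *+ 2 * s) = 1.
  by rewrite cosB cE sE -!expr2 cos2Dsin2.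
move=> /cos_eq1_int[m]; rewrite -mulrBr mulrC => /mulIf h; exists m; apply: h.
by rewrite gt_eqF// pmulrn_rgt0 ?pi_gt0.
Qed.

(** Through [circle_pt], a 1-periodic function is a function on a circle in the plane. By
    compatibility [t] descends to the compact image of [K], continuously since closed subsets of [K]
    have closed images, and Tietze's theorem extends it with the same bound. *)
Lemma periodic_extension (X : topologicalType) (K : set X) (q t : X -> R)
    (a : R) :
  compact K -> continuous q -> continuous t -> 0 <= a ->
  (forall x, K x -> `|t x| <= a) ->
  (forall x y, K x -> K y ->
     (exists m : int, q x - q y = m%:~R) -> t x = t y) ->
  exists phi : R -> R, [/\ continuous phi, zperiodic phi,
    forall x, K x -> phi (q x) = t x & forall r, `|phi r| <= a].
Proof.
move=> cK cq ct a0 ta tq.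
move: a0; rewrite le_eqVlt => /predU1P[a0|a0].
  (* The extension theorem is applied with a positive bound; for [a = 0] all prescribed values
     vanish. *)
  exists (fun=> 0); split => [x|//|x Kx|r]; first exact: cvg_cst.
    by apply/esym/normr0_eq0/eqP; rewrite eq_le normr_ge0 andbT a0; exact: ta.
  by rewrite normr0 -a0.
pose G := circle_pt \o q.
have cG : continuous G by apply: continuous_compT cq continuous_circle_pt.
pose A := G @` K.
have hP : hausdorff_space P by exact: norm_hausdorff.
have imK (L : set X) : compact L -> closed (G @` L).
  move=> cL; apply: (compact_closed hP); apply: continuous_compact => //.
  exact: continuous_subspaceT.
have clA : closed A by exact: imK.
pose f (z : P) : R := if pselect (A z) is left h then t (sval (cid2 h)) else 0.
have fG x : K x -> f (G x) = t x.
  move=> Kx; rewrite /f; case: pselect => [h|]; last by case; exists x.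
  by case: (cid2 h) => y Ky /= yx; apply: tq => //; exact: circle_pt_eq.
have cf : {within A, continuous f}.
  apply/continuous_closedP => C clC.
  rewrite -closed_setIS//.
  rewrite (_ : _ `&` _ = G @` (K `&` t @^-1` C)); last first.
    apply/seteqP; split=> [z [/= Cz [x Kx xz]]|_ [x [Kx Cx] <-]].
      by exists x => //; split => //=; rewrite -fG// xz.
    split; last by exists x.
    by change (C (f (G x))); rewrite fG.
  apply: imK; apply: compact_closedI => //.
  by apply: preimage_closed => //; exact: continuous_subspaceT.
have fa z : A z -> `|f z| <= a by move=> [x Kx <-]; rewrite fG// ta.
have [Phi [fPhi cPhi Phia]] :=
  continuous_bounded_extension (@pseudometric_normal R P) clA a0 cf fa.
exists (Phi \o circle_pt); split.
- by apply: (continuous_compT continuous_circle_pt).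
- by move=> r m /=; rewrite circle_pt_periodic.
- by move=> x Kx /=; rewrite -fPhi ?fG// inE; exists x.
- by move=> r; exact: Phia.
Qed.

(** Minkowski sum of the segments from [- a v] to [a v]. It contains the displacement of every point
    under a composition of shears with these amplitudes. *)
Fixpoint zonogon (l : seq (int * int * R)) (w : P) : Prop :=
  if l is (d, a) :: l' then
    exists2 tau, `|tau| <= a & zonogon l' (w - tau *: ztrans R d.1 d.2)
  else w = 0.

Section chain.
Variables (X : topologicalType) (K : set X).

(** [p] is the position after the stages already applied. A shear sees it only through [cross]
    modulo 1, so points of [K] that agree there must receive the same shift. *)
Fixpoint shear_chain (p : X -> P) (l : seq (int * int * R * (X -> R))) : Prop :=
  if l is (d, a, t) :: l' then
    [/\ continuous t, 0 <= a, forall x, K x -> `|t x| <= a,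
        forall x y, K x -> K y ->
          (exists m : int, cross (ztrans R d.1 d.2) (p x)
                         - cross (ztrans R d.1 d.2) (p y) = m%:~R) ->
          t x = t y
      & shear_chain (fun x => p x + t x *: ztrans R d.1 d.2) l']
  else True.

Lemma shear_chain_map (p : X -> P) l : compact K -> continuous p ->
  shear_chain p l ->
  exists h, [/\ torus_area_map h,
    forall x, K x -> h (p x) =
      p x + \sum_(s <- l) s.2 x *: ztrans R s.1.1.1 s.1.1.2
    & forall z, zonogon (map fst l) (h z - z)].
Proof.
move=> cK; elim: l p => [|[[d a] t] l IH] p cp /=.
  move=> _; exists id; split; first exact: torus_area_map_id.
  - by move=> x _; rewrite big_nil addr0.
  - by move=> z; rewrite subrr.
move=> [ct a0 ta tq chain]; set v := ztrans R d.1 d.2.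
have [phi [cphi pphi phiq phia]] := periodic_extension cK
  (continuous_compT cp (@continuous_cross R v)) ct a0 ta tq.
have cp' : continuous (fun x => p x + t x *: v).
  by apply: continuous_addT => //; exact: continuous_scaleT.
have [h [mh hp hz]] := IH _ cp' chain.
exists (h \o shear v phi); split.
- by apply: torus_area_map_comp => //; exact: torus_area_map_shear.
- by move=> x Kx /=; rewrite /shear phiq// hp// big_cons addrA.
- move=> z /=; exists (phi (cross v z)) => //.
  by have := hz (shear v phi z); rewrite {2}/shear opprD addrA.
Qed.

End chain.
End shear_chains.

(** * Cantor sets in general position *)

Section cantor_scheme.
Variable R : realType.
Local Notation P := (R * R)%type.

Lemma pair_norm_le (z : P) (r : R) :
  (`|z| <= r) = (`|z.1| <= r) && (`|z.2| <= r).
Proof. by case: z => a b; rewrite prod_normE/= ge_max. Qed.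

Lemma nested_intervals (l u : nat -> R) :
  (forall n, l n <= l n.+1) -> (forall n, u n.+1 <= u n) ->
  (forall n, l n <= u n) -> exists x, forall n, l n <= x <= u n.
Proof.
move=> l1 u1 lu.
have lm n m : (n <= m)%N -> l n <= l m by move: n m; exact/nondecreasing_seqP.
have um n m : (n <= m)%N -> u m <= u n by move: n m; exact/nonincreasing_seqP.
have lub n m : l n <= u m.
  by rewrite (le_trans (lm _ _ (leq_maxl n m)))// (le_trans (lu _))// um// leq_maxr.
have hs : has_sup (range l).
  by split; [exists (l 0%N); exists 0%N | exists (u 0%N) => _ [n _ <-]].
exists (sup (range l)) => n; apply/andP; split.
  by apply: sup_upper_bound => //; exists n.
by apply: sup_le_ub; [exact: hs.1 | move=> _ [m _ <-]].
Qed.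

Definition nonint (r : R) := forall m : int, r != m%:~R.

Lemma nonint_open (r : R) : nonint r -> \forall s \near r, nonint s.
Proof.
move=> rN; have /andP[fl fu] := floor_itv r.
have fl' : (Num.floor r)%:~R < r by rewrite lt_neqAle fl andbT eq_sym rN.
near=> s; move=> m; apply/eqP => sE.
have s1 : (Num.floor r)%:~R < s by near: s; exact: lt_nbhsr.
have s2 : s < (Num.floor r + 1)%:~R by near: s; exact: lt_nbhsl.
by move: s1 s2; rewrite sE !ltr_int; lia.
Unshelve. all: by end_near. Qed.

Section scheme.
Variables (J : finType) (q : J -> P -> R).
Hypothesis q_continuous : forall j, continuous (q j).
Hypothesis q_generic : forall j (b : P) (e r : R), 0 < e ->
  exists2 z, `|z - b| < e & nonint (q j z - r).

(** The two indices are independent: the function describing a given stage depends on the current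
    pair of letters, which may differ between two paths. *)
Definition zsep (z w : P) := forall j j', nonint (q j z - q j' w).

Lemma zsepC z w : zsep z w -> zsep w z.
Proof.
by move=> h j j' m; have := h j' j (- m); rewrite mulrNz -eqr_oppLR opprB.
Qed.

Lemma zsep_open z w : zsep z w ->
  \forall r \near 0^'+, forall z' w', `|z' - z| <= r -> `|w' - w| <= r ->
    zsep z' w'.
Proof.
move=> zw.
have : \forall x \near (z, w), forall j j', nonint (q j x.1 - q j' x.2).
  have FF : Filter (nbhs ((z, w) : P * P)) by apply: nbhs_filter.
  refine (@filter_forall _ _ (fun j (x : P * P) =>
    forall j', nonint (q j x.1 - q j' x.2)) _ FF _) => j.
  refine (@filter_forall _ _ (fun j' (x : P * P) =>
    nonint (q j x.1 - q j' x.2)) _ FF _) => j'.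
  have cq : continuous (fun x : P * P => q j x.1 - q j' x.2).
    apply: continuous_subT.
    - exact: (@continuous_compT _ _ _ fst (q j) (@continuous_fst P P) (@q_continuous j)).
    - exact: (@continuous_compT _ _ _ snd (q j') (@continuous_snd P P) (@q_continuous j')).
  exact: (cq (z, w) _ (nonint_open (zw j j'))).
move=> /nbhs_ballP[e /= e0 he].
near=> r => z' w' zz' ww'; apply: (he (z', w')).
have re : r < e by near: r; exact: nbhs_right_lt.
by split; rewrite -ball_normE/= distrC; [exact: le_lt_trans zz' re | exact: le_lt_trans ww' re].
Unshelve. all: by end_near. Qed.

(** Each condition is open and dense: once the first is met, the others are met inside a ball where
    it persists. *)
Lemma generic_point (C : seq (J * R)) (b : P) (e : R) : 0 < e ->
  exists2 z, `|z - b| < e & forall c, c \in C -> nonint (q c.1 z - c.2).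
Proof.
elim: C b e => [|[j r] C IH] b e e0; first by exists b; rewrite ?subrr ?normr0.
have [z zb zr] := q_generic j b r e0.
have : \forall w \near z, nonint (q j w - r) /\ `|w - b| < e.
  near=> w; split; near: w.
    have cq : continuous (fun w => q j w - r).
      by apply: continuous_subT => // x; exact: cvg_cst.
    exact: (cq z _ (nonint_open zr)).
  have cn : continuous (fun w : P => `|w - b|).
    apply: (continuous_compT _ (@norm_continuous R P)).
    by apply: continuous_subT => x; [exact: cvg_id | exact: cvg_cst].
  exact: (cn z _ (lt_nbhsl zb)).
move=> /nbhs_ballP[e' /= e'0 he].
have [w wz wC] := IH z e' e'0.
have [wr wb] : nonint (q j w - r) /\ `|w - b| < e.
  by apply: he; rewrite -ball_normE/= distrC.
by exists w => // c; rewrite inE => /orP[/eqP ->|/wC].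
Unshelve. all: by end_near. Qed.

Lemma generic_family (W : eqType) (L : seq W) (b : W -> P) (e : R) : 0 < e ->
  exists C : W -> P, (forall s, `|C s - b s| < e) /\
    {in L &, forall s s', s != s' -> zsep (C s) (C s')}.
Proof.
move=> e0; elim: L => [|s L [C [Cb CL]]].
  by exists b; split => // s; rewrite subrr normr0.
have [sL|sL] := boolP (s \in L).
  exists C; split => // s1 s2.
  by rewrite !inE => /predU1P[->|?] /predU1P[->|?]; exact: CL.
pose cs := [seq (jj.1, q jj.2 (C w)) | w <- L, jj <- enum {: J * J}].
have [z zb zC] := generic_point cs (b s) e0.
have zL w : w \in L -> zsep z (C w).
  move=> wL j j'; apply: (zC (j, q j' (C w))).
  by apply/allpairsP; exists (w, (j, j')); rewrite mem_enum.
exists (fun w => if w == s then z else C w); split.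
  by move=> w; case: eqP => [->|].
move=> s1 s2; rewrite !inE.
case: eqP => [->|n1]; case: eqP => [->|n2] //=; rewrite ?eqxx// => h1 h2 n12.
- exact: (zL _ h2).
- exact: zsepC (zL _ h1).
- exact: (CL _ _ h1 h2 n12).
Qed.

Variable T : finType.

(** Words grow at the head, so [behead s] is the parent of [s]. The finitely many words of length
    [n] are moved to generic positions; a small common radius then separates their balls and keeps
    each inside the parent's. *)
Lemma scheme_step (n : nat) (C : seq T -> P) (r : R) : 0 < r ->
  exists C' r', [/\ 0 < r', r' <= r / 2,
    forall s, `|C' s - C (behead s)| + r' <= r &
    forall s s', size s = n -> size s' = n -> s != s' ->
      forall z w, `|z - C' s| <= r' -> `|w - C' s'| <= r' -> zsep z w].
Proof.
move=> r0; have r20 : 0 < r / 2 by rewrite divr_gt0.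
have [C' [C'b C'L]] := generic_family [seq val t | t <- enum {: n.-tuple T}]
  (fun s => C (behead s)) r20.
have mem_words (s : seq T) (sn : size s == n) :
    s \in [seq val t | t <- enum {: n.-tuple T}].
  by apply/mapP; exists (Tuple sn); rewrite ?mem_enum.
have : \forall r' \near 0^'+, 0 < r' /\ r' <= r / 2 /\
    forall s s' : n.-tuple T, s != s' -> forall z w, `|z - C' s| <= r' ->
      `|w - C' s'| <= r' -> zsep z w.
  near=> r'; split; first by [].
  split; first by near: r'; exact: nbhs_right_le.
  near: r'; apply: filter_forall => s; apply: filter_forall => s'.
  have [->|ss'] := eqVneq s s'; first by apply: nearW.
  have /zsep_open : zsep (C' s) (C' s').
    by apply: C'L; rewrite ?mem_words ?size_tuple.
  apply: filterS => r' h _ z w; exact: h.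
move=> /filter_ex[r' [r'0 [r'r h]]]; exists C', r'; split => //.
  by move=> s; rewrite (splitr r) lerD// ltW.
move=> s s' /eqP sn /eqP s'n ss'.
exact: (h (Tuple sn) (Tuple s'n)).
Unshelve. all: by end_near. Qed.

Fixpoint word (xi : nat -> T) (n : nat) : seq T :=
  if n is n'.+1 then xi n :: word xi n' else [:: xi 0%N].

Lemma size_word xi n : size (word xi n) = n.+1.
Proof. by elim: n => //= n ->. Qed.

Lemma eq_word xi zeta n : (forall i, (i <= n)%N -> xi i = zeta i) ->
  word xi n = word zeta n.
Proof.
elim: n => [|n IH] h /=; first by rewrite h.
by rewrite h// IH// => i ni; apply: h; exact: leqW.
Qed.

Lemma word_inj xi zeta n i : word xi n = word zeta n -> (i <= n)%N ->
  xi i = zeta i.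
Proof.
elim: n i => [|n IH] i /=; first by case=> h; rewrite leqn0 => /eqP ->.
case=> h1 h2; rewrite leq_eqVlt => /predU1P[->//|]; rewrite ltnS.
exact: IH.
Qed.

(** [e xi] lies in nested balls centred at the words of [xi]. The radii at least halve at each
    level, which gives uniform continuity; distinct paths have distinct words at some level, where
    the balls are separated. *)
Lemma cantor_embedding (c : T -> P) (delta : R) : 0 < delta ->
  exists e : (nat -> T) -> P, [/\
    forall xi, `|e xi - c (xi 0%N)| <= delta,
    forall eps, 0 < eps -> exists n, forall xi zeta,
      (forall i, (i <= n)%N -> xi i = zeta i) -> `|e xi - e zeta| <= eps &
    forall xi zeta, xi <> zeta -> zsep (e xi) (e zeta)].
Proof.
move=> d0.
(* Positivity of the radius is a premise inside [good], so that every pair has a successor and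
   [choice] applies; [st0] then supplies it along the sequence. *)
pose good n (Cr Cr' : (seq T -> P) * R) := 0 < Cr.2 ->
  [/\ 0 < Cr'.2, Cr'.2 <= Cr.2 / 2,
    forall s, `|Cr'.1 s - Cr.1 (behead s)| + Cr'.2 <= Cr.2 &
    forall s s', size s = n.+2 -> size s' = n.+2 -> s != s' ->
      forall z w, `|z - Cr'.1 s| <= Cr'.2 -> `|w - Cr'.1 s'| <= Cr'.2 ->
      zsep z w].
have step0 n Cr : exists Cr', good n Cr Cr'.
  have [r0|r0] := ltP 0 Cr.2; last by exists Cr; rewrite /good ltNge r0.
  by have [C' [r' h]] := scheme_step n.+2 Cr.1 r0; exists (C', r') => _.
have [F FP] := choice (fun nCr => step0 nCr.1 nCr.2).
pose init : (seq T -> P) * R := (fun s => if s is t :: _ then c t else 0, delta).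
pose st := fix st n := if n is n'.+1 then F (n', st n') else init.
have st0 n : 0 < (st n).2.
  by elim: n => //= n IH; case: (FP (n, st n) IH).
pose x n xi := (st n).1 (word xi n).
pose r n := (st n).2.
have xr n xi : `|x n.+1 xi - x n xi| + r n.+1 <= r n.
  have [_ _ + _] := FP (n, st n) (st0 n).
  by move/(_ (word xi n.+1)).
have rS n : r n.+1 <= r n / 2 by case: (FP (n, st n) (st0 n)).
have exE xi : exists z : P, forall n, `|z - x n xi| <= r n.
  have comp (p : P -> R) : (forall z, `|p z| <= `|z|) ->
      (forall z w, p (z - w) = p z - p w) ->
      exists a, forall n, p (x n xi) - r n <= a <= p (x n xi) + r n.
    move=> pn pB.
    have pd n : `|p (x n.+1 xi) - p (x n xi)| <= r n - r n.+1.
      by rewrite -pB (le_trans (pn _))// lerBrDr.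
    apply: nested_intervals => n.
    - by have := pd n; rewrite ler_norml; lra.
    - by have := pd n; rewrite ler_norml; lra.
    - by have := st0 n; rewrite /r; lra.
  have [|//|a ha] := comp fst.
    by move=> z; have := lexx `|z|; rewrite {1}pair_norm_le => /andP[].
  have [|//|b hb] := comp snd.
    by move=> z; have := lexx `|z|; rewrite {1}pair_norm_le => /andP[].
  exists (a, b) => n; rewrite pair_norm_le/=.
  by move: (ha n) (hb n); rewrite !ler_norml; lra.
have [e eP] := choice exE.
exists e; split.
- by move=> xi; exact: (eP xi 0%N).
- move=> eps eps0.
  have rn n : r n <= delta / 2 ^+ n.
    elim: n => [|n IH]; first by rewrite expr0 divr1.
    by rewrite (le_trans (rS n))// exprSr invfM mulrA ler_pM2r// invr_gt0.
  have [n rne] : exists n, r n <= eps / 2.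
    exists (Num.truncn (delta / (eps / 2))).+1; set n := _.+1.
    have e20 : 0 < eps / 2 by rewrite divr_gt0.
    rewrite (le_trans (rn n))// ler_pdivrMr ?exprn_gt0// mulrC -ler_pdivrMr//.
    rewrite (le_trans (ltW (truncnS_gt _)))// -natrX ler_nat ltnW//.
    exact: ltn_expl.
  exists n => xi zeta h; have E : x n xi = x n zeta by rewrite /x (eq_word h).
  rewrite -(subrKA (x n xi)) (le_trans (ler_normD _ _))// (splitr eps) lerD//.
    by rewrite (le_trans (eP _ _)).
  by rewrite distrC E (le_trans (eP _ _)).
- move=> xi zeta xz.
  have [i xzi] : exists i, xi i <> zeta i.
    by apply: contrapT => /forallNP h; apply: xz; apply/funext => i; exact: contrapT.
  have [_ _ _ /(_ (word xi i.+1) (word zeta i.+1))] := FP (i, st i) (st0 i).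
  apply; rewrite ?size_word//; last 2 first.
  - exact: (eP xi i.+1).
  - exact: (eP zeta i.+1).
  by apply/eqP => /word_inj h; apply: xzi; exact: h.
Qed.

End scheme.
End cantor_scheme.

(** * Directions of the shears *)

Section euclidean_norm.
Variable R : realType.
Local Notation P := (R * R)%type.

Definition dot (z w : P) : R := z.1 * w.1 + z.2 * w.2.

Lemma enorm_ge0 (z : P) : 0 <= enorm z.
Proof. exact: sqrtr_ge0. Qed.

Lemma sqr_enorm (z : P) : enorm z ^+ 2 = dot z z.
Proof. by rewrite /enorm sqr_sqrtr ?addr_ge0 ?sqr_ge0// /dot !expr2. Qed.

Lemma enorm0 : enorm (0 : P) = 0.
Proof. by rewrite /enorm /= expr0n /= addr0 sqrtr0. Qed.

Lemma enorm_le (z : P) (r : R) : 0 <= r -> (enorm z <= r) = (dot z z <= r ^+ 2).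
Proof. by move=> r0; rewrite -sqr_enorm ler_sqr ?nnegrE ?enorm_ge0. Qed.

Lemma dot_le (z w : P) : dot z w <= enorm z * enorm w.
Proof.
rewrite (le_trans (ler_norm _))//.
rewrite -ler_sqr ?nnegrE ?mulr_ge0 ?enorm_ge0 ?normr_ge0// exprMn !sqr_enorm.
rewrite real_normK ?num_real// /dot; set a := z.1; set b := z.2.
by have := sqr_ge0 (a * w.2 - b * w.1); lra.
Qed.

Lemma enormD (z w : P) : enorm (z + w) <= enorm z + enorm w.
Proof.
rewrite enorm_le ?addr_ge0 ?enorm_ge0//.
have -> : dot (z + w) (z + w) = dot z z + dot w w + 2 * dot z w.
  by rewrite /dot /=; ring.
by rewrite sqrrD !sqr_enorm; have := dot_le z w; lra.
Qed.

Lemma enormZ (a : R) (z : P) : enorm (a *: z) = `|a| * enorm z.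
Proof.
by rewrite /enorm scale_pairE/= !exprMn -mulrDr sqrtrM ?sqr_ge0// sqrtr_sqr.
Qed.

Lemma enormN (z : P) : enorm (- z) = enorm z.
Proof. by rewrite /enorm /= !sqrrN. Qed.

Lemma enormB (z w : P) : enorm (z - w) = enorm (w - z).
Proof. by rewrite -enormN opprB. Qed.

Lemma enorm_sum (I : Type) (s : seq I) (f : I -> P) :
  enorm (\sum_(i <- s) f i) <= \sum_(i <- s) enorm (f i).
Proof.
elim: s => [|i s IH]; first by rewrite !big_nil enorm0.
by rewrite !big_cons (le_trans (enormD _ _))// lerD2l.
Qed.

Lemma norm_le_enorm (z : P) : `|z| <= enorm z.
Proof.
rewrite pair_norm_le; apply/andP; split;
  rewrite -ler_sqr ?nnegrE ?enorm_ge0// sqr_enorm real_normK ?num_real// /dot -!expr2.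
- by rewrite lerDl sqr_ge0.
- by rewrite lerDr sqr_ge0.
Qed.

Lemma enorm_le_norm (z : P) : enorm z <= 2 * `|z|.
Proof.
have : `|z| <= `|z| by []; rewrite {1}pair_norm_le => /andP[h1 h2].
rewrite enorm_le ?mulr_ge0// /dot -!expr2.
have : z.1 ^+ 2 <= `|z| ^+ 2 by rewrite -real_normK ?num_real// ler_sqr ?nnegrE.
have : z.2 ^+ 2 <= `|z| ^+ 2 by rewrite -real_normK ?num_real// ler_sqr ?nnegrE.
by have := sqr_ge0 `|z|; rewrite exprMn; lra.
Qed.

End euclidean_norm.

(** * Half edges of a regular polygon *)

Section polygon.
Variable R : realType.
Local Notation P := (R * R)%type.

(** Angles in [[0, pi]] with a sign suit a centrally symmetric polygon, half of whose vertices then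
    suffice. *)
Lemma polar (z : P) : exists beta (b : bool), 0 <= beta <= pi /\
  z = ((-1) ^+ b * enorm z) *: ((cos beta, sin beta) : P).
Proof.
have [z0|z0] := eqVneq (enorm z) 0.
  exists 0, false; split; first by rewrite lexx pi_ge0.
  rewrite z0 mulr0 scale0r; have := sqr_enorm z; rewrite z0 expr0n/= /dot -!expr2.
  move/eqP; rewrite eq_sym paddr_eq0 ?sqr_ge0// !sqrf_eq0 => /andP[/eqP h1 /eqP h2].
  by rewrite [LHS]surjective_pairing h1 h2.
have zp : 0 < enorm z by rewrite lt0r z0 enorm_ge0.
have [b zb] : exists b : bool, 0 <= (-1) ^+ b * z.2.
  have [h|h] := leP 0 z.2; first by exists false; rewrite expr0 mul1r.
  by exists true; rewrite expr1 mulN1r oppr_ge0 ltW.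
pose c : R := (-1) ^+ b * z.1 / enorm z.
have sb : ((-1) ^+ b * (-1) ^+ b = 1 :> R) by rewrite -signr_addb addbb.
have c2 : c ^+ 2 <= 1.
  rewrite /c !exprMn sqrr_sign mul1r exprVn ler_pdivrMr ?exprn_gt0// mul1r.
  by rewrite sqr_enorm /dot -!expr2 lerDl sqr_ge0.
have c1 : -1 <= c <= 1 by rewrite -ler_norml -ler_sqr ?nnegrE// expr1n real_normK ?num_real.
exists (acos c), b; split; first by rewrite acos_ge0// acos_lepi.
rewrite acosK ?in_itv//= sin_acos// scale_pairE/=.
have -> : Num.sqrt (1 - c ^+ 2) = (-1) ^+ b * z.2 / enorm z.
  rewrite -[RHS]ger0_norm ?divr_ge0 ?enorm_ge0// -sqrtr_sqr; congr Num.sqrt.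
  rewrite /c !exprMn !sqrr_sign !mul1r exprVn sqr_enorm /dot.
  have : dot z z != 0 by rewrite -sqr_enorm expf_neq0.
  by rewrite /dot => h; field.
rewrite [LHS]surjective_pairing /c; move: sb; set sg := (-1) ^+ b => sb.
by congr pair; rewrite -[LHS]mul1r -[X in X * _ = _]sb; field.
Qed.

Lemma cos_lip (a b : R) : `|cos a - cos b| <= `|a - b|.
Proof.
wlog ab : a b / a < b.
  move=> h; have [/h//|/h|->] := ltgtP a b; last by rewrite !subrr.
  by rewrite distrC [leRHS]distrC.
have [c _ E] := @MVT R cos (fun x => - sin x) a b ab
  (fun x _ => is_derive_cos x) (continuous_subspaceT (@continuous_cos R)).
rewrite distrC E [leRHS]distrC normrM normrN ler_piMl// ?sin_max//.
Qed.

Lemma sin_lip (a b : R) : `|sin a - sin b| <= `|a - b|.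
Proof.
rewrite -!cosBpihalf (le_trans (cos_lip _ _))//.
by rewrite (_ : _ - (b - pi / 2) = a - b)//; ring.
Qed.

(* [arc_length x] is the integral of [`|sin|] from [0] to [x], for [x] in
   [[-pi, pi]]; it dominates the variation of [cos]. *)
Let arc_length (x : R) : R := if 0 <= x then 1 - cos x else cos x - 1.

Let cos_variation (a b : R) : - pi <= a -> a <= b -> b <= pi ->
  `|cos b - cos a| <= arc_length b - arc_length a.
Proof.
move=> api ab bpi; rewrite /arc_length.
have cmono (x y : R) : 0 <= x -> x <= y -> y <= pi -> cos y <= cos x.
  move=> x0 xy ypi.
  have xin : x \in `[0, pi] by rewrite in_itv/= x0 (le_trans xy).
  have yin : y \in `[0, pi] by rewrite in_itv/= ypi (le_trans x0).
  by rewrite leNgt ltr_cos// -leNgt.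
have [a0|a0] := leP 0 a.
  rewrite (le_trans a0 ab) ler0_norm; first by lra.
  by rewrite subr_le0 cmono.
have [b0|b0] := leP 0 b.
  rewrite ler_norml; have := cos_le1 a; have := cos_le1 b; lra.
rewrite ger0_norm; first by lra.
by rewrite subr_ge0 -(cosN a) -(cosN b) cmono//; lra.
Qed.

Section regular_polygon.
Variables (r : R) (k : nat).
Hypotheses (r0 : 0 < r) (k0 : (0 < k)%N).
Let alpha : R := pi / k%:R.
Let vertex (j : nat) : P := (r * cos (j%:R * alpha), r * sin (j%:R * alpha)).
(** [vertex] runs over half of a regular polygon with [2 k] sides inscribed in the circle of radius
    [r]. This polygon is the Minkowski sum of the segments joining each half edge to its
    opposite. *)
Definition half_edge (i : nat) : P := 2^-1 *: (vertex i.+1 - vertex i).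

Let alpha_k : k%:R * alpha = pi.
Proof. by rewrite /alpha mulrCA divff ?mulr1// pnatr_eq0 -lt0n. Qed.

Let alpha_ge0 : 0 <= alpha.
Proof. by rewrite divr_ge0 ?pi_ge0. Qed.

(** The left side is the support function of the polygon. It is [r * enorm w / 2] times a sampled
    variation of [cos] over an interval of length [pi], where the total variation is 2. *)
Lemma sum_dot_half_edge (w : P) :
  \sum_(0 <= i < k) `|dot (half_edge i) w| <= r * enorm w.
Proof.
have [beta [b [/andP[b0 bpi] wE]]] := polar w.
pose f i := arc_length (i%:R * alpha - beta).
pose c := r * enorm w / 2.
have c0 : 0 <= c by rewrite divr_ge0 ?mulr_ge0 ?enorm_ge0// ltW.
apply: (@le_trans _ _ (\sum_(0 <= i < k) c * (f i.+1 - f i))).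
  apply: ler_sum_nat => i /andP[_ ik].
  have -> : dot (half_edge i) w = (-1) ^+ b * c *
      (cos (i.+1%:R * alpha - beta) - cos (i%:R * alpha - beta)).
    rewrite [in LHS]wE /half_edge !scale_pairE /dot/= !cosB /c.
    by set sg := (-1) ^+ b; field.
  rewrite 2!normrM normrX normrN1 expr1n mul1r (ger0_norm c0) ler_wpM2l//.
  have ia (j : nat) : (j <= k)%N -> 0 <= j%:R * alpha <= pi.
    move=> jk; rewrite mulr_ge0//= -[leRHS]alpha_k ler_wpM2r// ler_nat//.
  have /andP[h1 h2] := ia i (ltnW ik); have /andP[h3 h4] := ia i.+1 ik.
  apply: cos_variation; [lra | | lra].
  by rewrite lerD2r ler_wpM2r// ler_nat.
rewrite -big_distrr/= telescope_sumr// /f alpha_k mul0r sub0r /arc_length.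
rewrite subr_ge0 bpi oppr_ge0 cosB cospi sinpi cosN.
have [bz|bz] := leP beta 0.
  have -> : beta = 0 by apply/eqP; rewrite eq_le bz b0.
  by rewrite cos0 /c; have := mulr_ge0 (ltW r0) (enorm_ge0 w); lra.
by rewrite /c; lra.
Qed.

(** Pairing the sum [w] with itself bounds the square of [enorm w] by the support function at
    [w]. *)
Lemma half_edges_bound (s : nat -> R) : (forall i, `|s i| <= 1) ->
  enorm (\sum_(0 <= i < k) s i *: half_edge i) <= r.
Proof.
move=> s1; set w := \sum_(_ <= _ < _) _.
have [w0|w0] := eqVneq (enorm w) 0; first by rewrite w0 ltW.
have wp : 0 < enorm w by rewrite lt0r w0 enorm_ge0.
rewrite -(ler_pM2r wp) -expr2 sqr_enorm.
have -> : dot w w = \sum_(0 <= i < k) s i * dot (half_edge i) w.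
  have dotD x y : dot (x + y) w = dot x w + dot y w by rewrite /dot /=; ring.
  have dot0 : dot 0 w = 0 by rewrite /dot /= !mul0r addr0.
  rewrite {1}/w (big_morph (fun x => dot x w) dotD dot0).
  by apply: eq_bigr => i _; rewrite scale_pairE /dot/=; ring.
apply: le_trans (sum_dot_half_edge w); apply: ler_sum => i _.
by rewrite (le_trans (ler_norm _))// normrM ler_piMl.
Qed.

(** Both signs give telescoping sums, whose end terms cancel because the last vertex is opposite to
    the first. *)
Lemma half_edges_vertex (j : nat) : (j <= k)%N ->
  \sum_(0 <= i < k) (if (i < j)%N then 1 else -1) *: half_edge i = vertex j.
Proof.
move=> jk; rewrite (@big_cat_nat _ _ _ j)//=.
rewrite (@eq_big_nat _ _ _ 0 j _ half_edge); last first.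
  by move=> i /andP[_ ij]; rewrite ij scale1r.
rewrite (@eq_big_nat _ _ _ j k _ (fun i => - half_edge i)); last first.
  by move=> i /andP[ji _]; rewrite ltnNge ji scaleN1r.
rewrite sumrN /half_edge -!scaler_sumr !telescope_sumr//.
rewrite /vertex mul0r cos0 sin0 alpha_k cospi sinpi !scale_pairE.
by congr pair => /=; field.
Qed.

(** Up to sign, [u] is [enorm u / r] times a point of the upper half circle; the vertex just before
    that point replaces it, with an error of at most one arc. *)
Lemma half_edges_approx (u : P) : enorm u <= r -> exists s : nat -> R,
  (forall i, `|s i| <= 1) /\
  `|u - \sum_(0 <= i < k) s i *: half_edge i| <= r * alpha.
Proof.
move=> ur; have [beta [b [/andP[b0 bpi] uE]]] := polar u.
have alpha0 : 0 < alpha by rewrite divr_gt0 ?pi_gt0// ltr0n.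
pose j := Num.truncn (beta / alpha).
have ba0 : 0 <= beta / alpha by rewrite divr_ge0.
have /andP[j1 j2] : j%:R <= beta / alpha < j.+1%:R by exact: truncn_itv.
have jb : `|beta - j%:R * alpha| <= alpha.
  rewrite ler_pdivlMr// in j1; rewrite ltr_pdivrMr// in j2.
  by rewrite -natr1 mulrDl mul1r in j2; rewrite ger0_norm; lra.
have jk : (j <= k)%N.
  rewrite -(ler_nat R) (le_trans j1)// ler_pdivrMr// alpha_k//.
pose c := (-1) ^+ b * (enorm u / r).
have cn : `|c| = enorm u / r.
  by rewrite normrM normrX normrN1 expr1n mul1r ger0_norm// divr_ge0 ?enorm_ge0// ltW.
exists (fun i => c * (if (i < j)%N then 1 else -1)); split.
  move=> i; rewrite normrM cn (_ : `|_| = 1) ?mulr1 ?ler_pdivrMr ?mul1r//.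
  by case: ifP; rewrite ?normrN normr1.
under eq_bigr => i _ do rewrite -scalerA.
rewrite -scaler_sumr half_edges_vertex// {1}uE /vertex !scale_pairE /c pair_norm_le/=.
have bd (x y : R) : `|x - y| <= `|beta - j%:R * alpha| ->
    `|(-1) ^+ b * enorm u * x - (-1) ^+ b * (enorm u / r) * (r * y)| <= r * alpha.
  move=> xy; have -> : (-1) ^+ b * enorm u * x - (-1) ^+ b * (enorm u / r) * (r * y)
     = (-1) ^+ b * enorm u * (x - y) by field; rewrite gt_eqF.
  rewrite 2!normrM normrX normrN1 expr1n mul1r ger0_norm ?enorm_ge0//.
  by apply: ler_pM; rewrite ?enorm_ge0// (le_trans xy jb).
by rewrite (bd _ _ (cos_lip _ _)) (bd _ _ (sin_lip _ _)).
Qed.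

End regular_polygon.
End polygon.

(** * Rounding the half edges to integer directions *)

Section zonogon.
Variable R : realType.
Local Notation P := (R * R)%type.

Lemma zonogonP (s : seq nat) (d : nat -> int * int) (a : nat -> R) (w : P) :
  uniq s -> zonogon [seq (d i, a i) | i <- s] w <->
  exists tau : nat -> R, {in s, forall i, `|tau i| <= a i} /\
    w = \sum_(i <- s) tau i *: ztrans R (d i).1 (d i).2.
Proof.
elim: s w => [|i s IH] w /=.
  by move=> _; split=> [->|[tau [_ ->]]]; rewrite ?big_nil//; exists (fun=> 0);
    rewrite big_nil.
move=> /andP[iNs us]; split.
  move=> [t ta /(IH _ us)[tau [tau_a wE]]].
  exists (fun j => if j == i then t else tau j); split.
    move=> j; rewrite inE; case: eqP => [->//|_] /= js; exact: tau_a.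
  rewrite big_cons eqxx -[LHS](subrK (t *: ztrans R (d i).1 (d i).2)) wE addrC.
  congr +%R; apply: eq_big_seq => j js.
  by case: eqP => // ji; rewrite -ji js in iNs.
move=> [tau [tau_a ->]]; exists (tau i); first by apply: tau_a; rewrite mem_head.
apply/(IH _ us); exists tau; split.
  by move=> j js; apply: tau_a; rewrite inE js orbT.
by rewrite big_cons addrC addKr.
Qed.

(** The number [k] of edges is fixed first, so that the polygon fills the disc up to [eta / 2]; the
    denominator [D] comes next and makes the sum of the [k] rounding errors at most [eta / 2]. *)
Lemma zonogon_approx (r eta : R) : 0 < r -> 0 < eta ->
  exists l : seq (int * int * R), [/\
    forall s, s \in l -> s.1 != (0, 0) /\ 0 <= s.2,
    forall w, zonogon l w -> enorm w <= r + eta &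
    forall u, enorm u <= r -> exists2 w, zonogon l w & `|u - w| <= eta].
Proof.
move=> r0 eta0.
pose k := (Num.truncn (2 * (r * pi) / eta)).+1.
have k0 : 0 < k%:R :> R by rewrite ltr0n.
have rk : r * (pi / k%:R) <= eta / 2.
  have : 2 * (r * pi) / eta < k%:R by exact: truncnS_gt.
  by rewrite ltr_pdivrMr// => h; rewrite mulrA ler_pdivrMr//; lra.
pose D := (Num.truncn (8 * k%:R / eta)).+1.
have D0 : 0 < D%:R :> R by rewrite ltr0n.
have kD : k%:R * (2 * D%:R^-1) <= eta / 2.
  have : 8 * k%:R / eta < D%:R by exact: truncnS_gt.
  rewrite ltr_pdivrMr// => h; rewrite mulrA ler_pdivrMr//; lra.
pose v := half_edge r k.
(* A zero rounding has no direction and is replaced by [(1, 0)]: both coordinates of the scaled half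
   edge then lie in [0, 1), so the error stays at most 1. *)
pose d i : int * int :=
  let z := (Num.floor (D%:R * (v i).1), Num.floor (D%:R * (v i).2)) in
  if z == (0, 0) then (1, 0) else z.
have dv i : `|D%:R *: v i - ztrans R (d i).1 (d i).2| <= 1.
  have := floor_itv (D%:R * (v i).1); have := floor_itv (D%:R * (v i).2).
  rewrite scale_pairE pair_norm_le/= /d.
  case: eqP => [[-> ->]|_] /=; rewrite !intrD /= !ler_norml; lra.
pose a (i : nat) : R := D%:R^-1.
exists [seq (d i, a i) | i <- index_iota 0 k]; split.
- move=> s /mapP[i _ ->] /=; split; last by rewrite invr_ge0 ltW.
  by rewrite /d; case: ifPn.
- move=> w /(zonogonP _ _ _ (iota_uniq _ _))[tau [tau_a ->]].
  pose s i := if (i < k)%N then D%:R * tau i else 0.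
  have s1 i : `|s i| <= 1.
    rewrite /s; case: ifP => ik; last by rewrite normr0.
    rewrite normrM gtr0_norm// mulrC -ler_pdivlMr// div1r.
    by apply: tau_a; rewrite mem_iota/= add0n subn0.
  have -> : \sum_(i <- index_iota 0 k) tau i *: ztrans R (d i).1 (d i).2 =
      \sum_(0 <= i < k) s i *: v i + \sum_(0 <= i < k)
        (- (D%:R^-1 * s i) *: (D%:R *: v i - ztrans R (d i).1 (d i).2)).
    rewrite -big_split/=; apply: eq_big_nat => i /andP[_ ik]; rewrite /s ik.
    rewrite mulKf ?gt_eqF// !scale_pairE; congr pair => /=; ring.
  rewrite (le_trans (enormD _ _))// lerD//; first exact: half_edges_bound.
  apply: (@le_trans _ _ (\sum_(0 <= i < k) 2 * D%:R^-1)); last first.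
    by rewrite sumr_const_nat subn0 -[_ *+ k]mulr_natl; lra.
  rewrite (le_trans (enorm_sum _ _))//; apply: ler_sum => i _.
  rewrite enormZ normrN normrM (gtr0_norm (_ : 0 < D%:R^-1)) ?invr_gt0//.
  have h := le_trans (enorm_le_norm _) (ler_wpM2l (ler0n R 2) (dv i)).
  rewrite mulr1 in h.
  rewrite -mulrA [leRHS]mulrC; apply: ler_wpM2l; first by rewrite invr_ge0 ltW.
  by rewrite -[leRHS]mul1r; apply: ler_pM; rewrite ?enorm_ge0.
- move=> u ur; have [s [s1 us]] := half_edges_approx r0 (ltn0Sn _ : (0 < k)%N) ur.
  exists (\sum_(0 <= i < k) (s i / D%:R) *: ztrans R (d i).1 (d i).2).
    apply/(zonogonP _ _ _ (iota_uniq _ _)); exists (fun i => s i / D%:R).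
    by split=> // i _; rewrite /a normrM normfV (gtr0_norm D0) ler_piMl// invr_ge0 ltW.
  have -> : u - \sum_(0 <= i < k) (s i / D%:R) *: ztrans R (d i).1 (d i).2 =
      (u - \sum_(0 <= i < k) s i *: v i) + \sum_(0 <= i < k)
        (s i / D%:R) *: (D%:R *: v i - ztrans R (d i).1 (d i).2).
    rewrite -addrA; congr +%R; rewrite addrC -sumrB -sumrN.
    apply: eq_bigr => i _; rewrite !scale_pairE; congr pair => /=; field;
      by rewrite gt_eqF.
  rewrite (le_trans (ler_normD _ _))// (splitr eta) lerD//.
    exact: le_trans us rk.
  apply: le_trans kD; apply: (@le_trans _ _ (\sum_(0 <= i < k) D%:R^-1)); last first.
    rewrite sumr_const_nat subn0 -[D%:R^-1 *+ k]mulr_natl ler_pM2l//.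
    by rewrite ler_peMl ?invr_ge0 ?(ltW D0)// ler1n.
  rewrite (le_trans (ler_norm_sum _ _ _))//; apply: ler_sum => i _.
  rewrite normrZ -[leRHS]mulr1 ler_pM//.
  by rewrite normrM normfV (gtr0_norm D0) ler_piMl// invr_ge0 ltW.
Qed.

End zonogon.

(** * Shadowing all pseudo-orbits by one homeomorphism *)

Section shadowing.
Variable R : realType.
Local Notation P := (R * R)%type.

Lemma zonogon_cat (l1 l2 : seq (int * int * R)) (w : P) :
  zonogon (l1 ++ l2) w ->
  exists w1 w2, [/\ w = w1 + w2, zonogon l1 w1 & zonogon l2 w2].
Proof.
elim: l1 w => [|[d a] l1 IH] w /=; first by exists 0, w; rewrite add0r.
move=> [tau ta /IH[w1 [w2 [wE h1 h2]]]].
exists (tau *: ztrans R d.1 d.2 + w1), w2; split => //.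
  by rewrite -addrA -wE addrC subrK.
by exists tau => //; rewrite addrAC subrr add0r.
Qed.

Lemma zonogon_split (I : Type) (l : seq (int * int * R)) (w : I -> P) :
  (forall i, zonogon l (w i)) ->
  exists lt : seq (int * int * R * (I -> R)), [/\ map fst lt = l,
    forall s0 k, (k < size lt)%N -> forall i,
      `|(nth s0 lt k).2 i| <= (nth s0 lt k).1.2 &
    forall i, w i = \sum_(s <- lt) s.2 i *: ztrans R s.1.1.1 s.1.1.2].
Proof.
elim: l w => [|[d a] l IH] w /= h.
  by exists [::]; split => // i; rewrite big_nil.
have h' i : exists t, `|t| <= a /\ zonogon l (w i - t *: ztrans R d.1 d.2).
  by have [t ta wt] := h i; exists t.
have [tau tauP] := choice h'.
have [lt [ltl lta ltw]] := IH _ (fun i => (tauP i).2).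
exists ((d, a, tau) :: lt); split => /=.
- by rewrite ltl.
- by move=> s0 [_ i|k /lta]; [exact: (tauP i).1 | exact].
- by move=> i; rewrite big_cons -ltw /= addrC subrK.
Qed.

(** Moving [F z] along the normal [n] of [v] changes [cross v] at a nonzero rate, and continuity of
    the inverse of [F] keeps the preimage near [b]. *)
Lemma cross_generic (F : P -> P) (v p : P) : homeo F -> v != 0 ->
  forall (b : P) (e r : R), 0 < e ->
  exists2 z, `|z - b| < e & nonint (cross v (F z + p) - r).
Proof.
move=> [cF [F' [cF' [FK F'K]]]] v0 b e r e0.
have : \forall y \near F b, `|F' y - b| < e.
  have cn : continuous (fun y => `|F' y - b|).
    apply: (continuous_compT _ (@norm_continuous R P)).
    by apply: continuous_subT => // x; exact: cvg_cst.
  have be : `|F' (F b) - b| < e by rewrite FK subrr normr0.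
  exact: (cn (F b) _ (lt_nbhsl be)).
move=> /nbhs_ballP[rho /= rho0 hrho].
pose n : P := (- v.2, v.1).
have N0 : 0 < cross v n.
  rewrite /cross /= mulrN opprK -!expr2 lt0r addr_ge0 ?sqr_ge0// andbT.
  rewrite paddr_eq0 ?sqr_ge0// !sqrf_eq0; apply: contra v0 => /andP[/eqP h1 /eqP h2].
  by rewrite [v]surjective_pairing h1 h2.
set N := cross v n in N0.
pose c0 := cross v (F b + p) - r.
have near_b (s : R) : `|s| * `|n| < rho -> nonint (c0 + s * N) ->
    exists2 z, `|z - b| < e & nonint (cross v (F z + p) - r).
  move=> sn hs; exists (F' (F b + s *: n)).
    by apply: hrho; rewrite -ball_normE/= opprD addrA subrr add0r normrN normrZ.
  rewrite F'K (addrAC (F b)) crossD crossZ -/N.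
  by rewrite (_ : _ - r = c0 + s * N)// /c0; ring.
have [c0N|] := pselect (nonint c0).
  by apply: (near_b 0); rewrite ?normr0 ?mul0r ?addr0.
move=> /existsNP[m /negP]; rewrite negbK => /eqP c0m.
(* The first term limits the change of [cross v] to 1/2, so an integer value becomes non-integer;
   the second keeps the moved image within [rho]. *)
pose s := Num.min (2 * N)^-1 (rho / (2 * (`|n| + 1))).
have n1 : 0 < `|n| + 1 by rewrite ltr_wpDl.
have s0 : 0 < s by rewrite lt_min invr_gt0 !mulr_gt0//= invr_gt0 mulr_gt0.
apply: (near_b s).
  rewrite gtr0_norm//; apply: (@le_lt_trans _ _ (rho / (2 * (`|n| + 1)) * `|n|)).
    by rewrite ler_wpM2r// ge_min lexx orbT.
  rewrite -mulrA gtr_pMr// mulrC ltr_pdivrMr ?mulr_gt0// mul1r.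
  have := normr_ge0 n; lra.
move=> k; rewrite c0m; apply/eqP => kE.
have sN : 0 < s * N <= 1 / 2.
  rewrite mulr_gt0//= -ler_pdivlMr// mul1r -invfM ge_min lexx//.
have h1 : (m%:~R < k%:~R :> R) by lra.
have h2 : (k%:~R < (m + 1)%:~R :> R) by rewrite intrD; lra.
by move: h1 h2; rewrite !ltr_int; lia.
Qed.

(** The enumeration starts at 0, so that the first letter read by [cantor_embedding], which selects
    the centre, is the current one. *)
Definition zigzag (n : nat) : int :=
  if odd n then - (n./2.+1)%:Z else (n./2)%:Z.

Lemma zigzag_surj (i : int) : exists n, zigzag n = i.
Proof.
case: i => m; [exists m.*2 | exists m.*2.+1]; rewrite /zigzag /= odd_double/=.
  by rewrite doubleK.
by rewrite uphalf_double NegzE.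
Qed.

End shadowing.

(** * The compact space of itineraries *)

Section shadowing.
Variable R : realType.
Local Notation P := (R * R)%type.
Section itineraries.
Variable T : finType.
Let X := prod_topology (fun _ : int => discrete_topology T).

Lemma itineraries_compact : compact [set: X].
Proof.
have cT : compact [set: discrete_topology T].
  by apply: finite_compact; exact: (@finite_finset T).
have := @tychonoff int (fun=> discrete_topology T) (fun=> setT) (fun=> cT).
by congr (compact _); rewrite eqEsubset.
Qed.

Lemma continuous_itinerary (V : normedModType R) (f : (nat -> T) -> V)
    (g : nat -> int) :
  (forall eps, 0 < eps -> exists n, forall xi zeta,
      (forall i, (i <= n)%N -> xi i = zeta i) -> `|f xi - f zeta| <= eps) ->
  continuous (fun xi : X => f (fun i => xi (g i)) : V).
Proof.
move=> fc xi A /nbhs_ballP[eps /= eps0 hA].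
have [|n hn] := fc (eps / 2); first by rewrite divr_gt0.
have FF : Filter (nbhs (xi : X)) by apply: nbhs_filter.
have : \forall zeta \near (xi : X), forall i : 'I_n.+1, zeta (g i) = xi (g i).
  refine (@filter_forall _ _ (fun (i : 'I_n.+1) (zeta : X) =>
    zeta (g i) = xi (g i)) _ FF _) => i.
  exact: (@proj_continuous _ (fun=> discrete_topology T) (g i) xi _
    (discrete_set1 (xi (g i)))).
apply: (@filterS _ _ FF) => zeta h; apply: hA; rewrite -ball_normE/=.
apply: (@le_lt_trans _ _ (eps / 2)); last by rewrite ltr_pdivrMr// ltr_pMr// ltr1n.
apply: hn => i ni; apply/esym.
by have := h (Ordinal (ni : (i < n.+1)%N)).
Qed.

Lemma continuous_letters (f : T -> T -> R) :
  continuous (fun xi : X => f (xi 0) (xi 1)).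
Proof.
apply: (@continuous_itinerary R^o (fun xi => f (xi 0%N) (xi 1%N)) (fun i => i%:Z)).
move=> eps eps0; exists 1%N => xi zeta h.
by rewrite !h// subrr normr0 ltW.
Qed.

End itineraries.
End shadowing.

(** * Realizing the shift of itineraries by a homeomorphism *)

Section shadowing_map.
Variable R : realType.
Local Notation P := (R * R)%type.
Variables (area : bool) (F : P -> P) (eps eps' : R).
Hypotheses (FH : in_H area F) (eps'0 : 0 < eps') (eps'eps : eps' < eps).
Variables (T : finType) (c : T -> P) (w : T -> int * int) (delta : R).
Hypothesis delta0 : 0 < delta.

Let X := prod_topology (fun _ : int => discrete_topology T).
(** A letter is a grid point [c t] together with the integer translation [w t] made on reaching
    it. *)
Let W (t : T) : P := ztrans R (w t).1 (w t).2.
Let edge (a b : T) : bool := enorm (F (c a) - c b - W b) <= eps'.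
(** Budget: the polygon shears displace by at most [eps' + eta] and the two correcting shears by at
    most [6 * eta], which leaves a margin of one [eta] below [eps]. *)
Let eta : R := (eps - eps') / 8.

Let eta0 : 0 < eta.
Proof. by rewrite divr_gt0// subr_gt0. Qed.

Let F_near : exists2 d, 0 < d <= delta & d <= eta /\
  forall t z, `|z - c t| <= d -> `|F z - F (c t)| <= eta.
Proof.
have : \forall d \near (0 : R)^'+, forall t : T, forall z, `|z - c t| <= d ->
    `|F z - F (c t)| <= eta.
  apply: filter_forall => t.
  have cF : continuous F by case: FH => -[[]].
  have : \forall z \near c t, `|F z - F (c t)| <= eta.
    have cn : continuous (fun z => `|F z - F (c t)|).
      apply: (continuous_compT _ (@norm_continuous R P)).
      by apply: continuous_subT => // x; exact: cvg_cst.
    have be : `|F (c t) - F (c t)| < eta by rewrite subrr normr0.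
    have FF : Filter (nbhs (c t)) by apply: nbhs_filter.
    by apply: (@filterS _ _ FF) (cn (c t) _ (lt_nbhsl be)) => z /ltW.
  move=> /nbhs_ballP[rho /= rho0 hrho]; near=> d => z zd.
  have dr : d < rho by near: d; exact: nbhs_right_lt.
  by apply: hrho; rewrite -ball_normE/= distrC (le_lt_trans zd).
move=> h; have [d [d0 [dd [de hd]]]] : exists d : R, 0 < d /\ d <= delta /\
    d <= eta /\ forall t z, `|z - c t| <= d -> `|F z - F (c t)| <= eta.
  apply: (@filter_ex _ (0 : R)^'+); near=> d; split; first by [].
  split; first by near: d; exact: nbhs_right_le.
  split; first by near: d; exact: nbhs_right_le.
  by near: d.
by exists d; rewrite ?d0.
Unshelve. all: by end_near. Qed.

(** The moves [u] of the polygon shears depend on two letters only. Their error [eta] and the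
    offsets of the Cantor points from the grid are left to the correcting shears. *)
Let steps : exists (l : seq (int * int * R)) (lt : seq (int * int * R * (T * T -> R)))
    (u : T * T -> P), [/\
    forall s, s \in l -> s.1 != (0, 0) /\ 0 <= s.2,
    forall x, zonogon l x -> enorm x <= eps' + eta,
    map fst lt = l,
    forall s0 k, (k < size lt)%N -> forall i,
      `|(nth s0 lt k).2 i| <= (nth s0 lt k).1.2 &
    (forall i, u i = \sum_(s <- lt) s.2 i *: ztrans R s.1.1.1 s.1.1.2) /\
    (forall a b, edge a b -> `|c b + W b - F (c a) - u (a, b)| <= eta)].
Proof.
have [l [l1 l2 l3]] := zonogon_approx eps'0 eta0.
have h (ab : T * T) : exists x, zonogon l x /\ (edge ab.1 ab.2 ->
    `|c ab.2 + W ab.2 - F (c ab.1) - x| <= eta).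
  have [e|e] := boolP (edge ab.1 ab.2).
    have [|x zx hx] := l3 (c ab.2 + W ab.2 - F (c ab.1)); last by exists x.
    by rewrite -enormN opprB opprD addrA.
  by have [|x zx hx] := l3 0; [rewrite enorm0 ltW | exists x].
have [u uP] := choice h.
have [lt [lt1 lt2 lt3]] := zonogon_split (fun i => (uP i).1).
exists l, lt, u; split => //; split => // a b; exact: (uP (a, b)).2.
Qed.

Lemma shadowing_map : exists G, [/\ in_H area G, dC0 F G < eps &
  forall n (b : nat -> T),
    (forall t, (t < n)%N ->
      enorm (F (c (b t)) - c (b t.+1) - ztrans R (w (b t.+1)).1 (w (b t.+1)).2)
        <= eps') ->
    exists z : nat -> P, (forall t, `|z t - c (b t)| <= delta) /\
      forall t, (t < n)%N ->
        G (z t) = z t.+1 + ztrans R (w (b t.+1)).1 (w (b t.+1)).2].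
Proof.
have [d /andP[d0 ddelta] [deta hd]] := F_near.
have [l [lt [u [l1 l2 ltl lta [uE ue]]]]] := steps.
have FHo : homeo F by case: FH => -[].
have cF : continuous F by case: FHo.
(* The default direction [(1, 0)] is that of the first correcting shear, so index [size lt] in [J]
   reads this extra stage. *)
pose s0 : int * int * R * (T * T -> R) := ((1, 0), 0, fun=> 0).
pose dir (s : int * int * R * (T * T -> R)) : P := ztrans R s.1.1.1 s.1.1.2.
pose pre (pr : seq (int * int * R * (T * T -> R))) ab : P :=
  \sum_(s <- pr) s.2 ab *: dir s.
(* These index all values to be kept distinct modulo 1: one function for each stage and pair of
   letters, and [inr tt] for the last shear. *)
pose J : finType := ('I_(size lt).+1 * (T * T) + unit)%type.
pose q (j : J) : P -> R := match j with
  | inl (k, ab) => fun z => cross (dir (nth s0 lt k)) (F z + pre (take k lt) ab)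
  | inr _ => cross (ztrans R 0 1)
  end.
have dir0 (p : int * int) : p != (0, 0) -> ztrans R p.1 p.2 != 0.
  case: p => p1 p2; apply: contraNneq => -[/eqP + /eqP]; rewrite !intr_eq0.
  by move=> /eqP -> /eqP ->.
have qc j : continuous (q j).
  case: j => [[k ab]|_] /=; last exact: continuous_cross.
  apply: (continuous_compT _ (@continuous_cross R _)).
  by apply: continuous_addT => // x; exact: cvg_cst.
have lt_dir k : (nth s0 lt k).1.1 != (0, 0).
  have [kl|kl] := ltnP k (size lt); last by rewrite nth_default.
  have : (nth s0 lt k).1 \in l by rewrite -ltl -(nth_map s0 s0.1)// mem_nth// size_map.
  by move/l1 => [].
have qg j (b : P) (e r : R) : 0 < e ->
    exists2 z, `|z - b| < e & nonint (q j z - r).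
  case: j => [[k ab]|_] /= e0.
    by apply: cross_generic => //; apply: dir0; exact: lt_dir.
  have hid : homeo (@id P).
    by split=> [x|]; [exact: cvg_id | exists id; split=> // x; exact: cvg_id].
  have v0 : ztrans R 0 1 != 0 by apply: (dir0 (0, 1)).
  have [z zb hz] := cross_generic 0 hid v0 b r e0.
  by exists z => //; rewrite addr0 in hz.
have [e [ec econt esep]] := cantor_embedding qc qg c d0.
pose E (xi : X) : P := e (fun i => xi (zigzag i)).
(* The point of the shifted path: [G] has to send [E xi] there, up to the translation [W (xi 1)]. *)
pose Es (xi : X) : P := e (fun i => xi (zigzag i + 1)).
have cE : continuous E by apply: (@continuous_itinerary R T (R * R)%type e zigzag).
have cEs : continuous Es by apply: (@continuous_itinerary R T (R * R)%type e (fun i => zigzag i + 1)).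
have E_c xi : `|E xi - c (xi 0)| <= d by exact: (ec (fun i => xi (zigzag i))).
have Es_c xi : `|Es xi - c (xi 1)| <= d by exact: (ec (fun i => xi (zigzag i + 1))).
have E_sep (xi zeta : X) j j' (m : int) :
    q j (E xi) - q j' (E zeta) = m%:~R -> xi = zeta.
  move=> qE; apply: contrapT => xz.
  have ne : (fun i => xi (zigzag i)) <> (fun i => zeta (zigzag i)).
    move=> h; apply: xz; apply/funext => i; have [k <-] := zigzag_surj i.
    by have := congr1 (fun g => g k) h.
  by have := esep _ _ ne j j' m; rewrite -qE eqxx.
have Es_sep (xi zeta : X) j j' (m : int) :
    q j (Es xi) - q j' (Es zeta) = m%:~R -> xi = zeta.
  move=> qE; apply: contrapT => xz.
  have ne : (fun i => xi (zigzag i + 1)) <> (fun i => zeta (zigzag i + 1)).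
    move=> h; apply: xz; apply/funext => i; have [k ki] := zigzag_surj (i - 1).
    by have := congr1 (fun g => g k) h; rewrite /= ki subrK.
  by have := esep _ _ ne j j' m; rewrite -qE eqxx.
pose K : set X := [set xi | edge (xi 0) (xi 1)].
have cK : compact K.
  apply: (subclosed_compact _ (@itineraries_compact T)) => //.
  have -> : K = (fun xi : X => (edge (xi 0) (xi 1))%:R : R) @^-1` [set 1].
    apply/seteqP; split=> xi; rewrite /K /=; first by move=> ->.
    by case: (edge _ _) => // /esym/eqP; rewrite oner_eq0.
  apply: preimage_closed; last exact: closed_eq.
  move=> xi _; exact: (@continuous_letters R T (fun a b => (edge a b)%:R)).
pose ab (xi : X) : T * T := (xi 0, xi 1).
pose corr (xi : X) : P := Es xi + W (xi 1) - F (E xi) - u (ab xi).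
(* One [eta] each for the polygon approximation, the distance from [Es xi] to its grid point, and
   the variation of [F] near [c (xi 0)]. *)
have corrK xi : K xi -> `|corr xi| <= 3 * eta.
  move=> Kxi.
  have -> : corr xi = (c (xi 1) + W (xi 1) - F (c (xi 0)) - u (ab xi)) +
      ((Es xi - c (xi 1)) - (F (E xi) - F (c (xi 0)))).
    by rewrite /corr; congr pair => /=; ring.
  have h1 := ue _ _ Kxi; have h2 := Es_c xi; have h3 := hd _ _ (E_c xi).
  rewrite (le_trans (ler_normD _ _))//.
  have := ler_normB (Es xi - c (xi 1)) (F (E xi) - F (c (xi 0))).
  rewrite -/(ab xi) in h1 *; lra.
have eta3 : 0 <= 3 * eta by have := eta0; lra.
have cletters (f : T * T -> R) : continuous (fun xi : X => f (ab xi)).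
  exact: (@continuous_letters R T (fun a b => f (a, b))).
have cW : continuous (fun xi : X => W (xi 1)).
  apply: continuous_pair.
    exact: (@continuous_letters R T (fun a b => (W b).1)).
  exact: (@continuous_letters R T (fun a b => (W b).2)).
have cu : continuous (fun xi : X => u (ab xi)).
  have -> : (fun xi : X => u (ab xi)) = (fun xi => ((u (ab xi)).1, (u (ab xi)).2)).
    by apply/funext => xi; rewrite -surjective_pairing.
  apply: continuous_pair; first exact: (cletters (fun i => (u i).1)).
  exact: (cletters (fun i => (u i).2)).
have cFE : continuous (fun xi => F (E xi)) by apply: (continuous_compT cE cF).
have ccorr : continuous corr.
  apply: continuous_subT cu; apply: continuous_subT cFE.
  exact: continuous_addT.
pose stage (s : int * int * R * (T * T -> R)) : int * int * R * (X -> R) :=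
  (s.1, fun xi => s.2 (ab xi)).
pose last2 : seq (int * int * R * (X -> R)) :=
  [:: ((1, 0), 3 * eta, fun xi => (corr xi).1);
      ((0, 1), 3 * eta, fun xi => (corr xi).2)].
have preE i : pre lt i = u i by rewrite uE.
have chain_last : shear_chain K (fun xi => F (E xi) + pre lt (ab xi)) last2.
  split => //=.
  - exact: (continuous_compT ccorr (@continuous_fst _ _)).
  - by move=> xi /corrK; rewrite pair_norm_le => /andP[].
  - move=> x y Kx Ky [m mE].
    suff -> : x = y by [].
    apply: (E_sep x y (inl (ord_max, ab x)) (inl (ord_max, ab y)) m).
    by rewrite /q /= nth_default// take_size.
  (* The first correction has already given the point the first coordinate of its target, so
     separation is tested on the shifted paths; the translations [W] only add an integer. *)
  split => //=.
  - exact: (continuous_compT ccorr (@continuous_snd _ _)).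
  - by move=> xi /corrK; rewrite pair_norm_le => /andP[].
  - move=> x y Kx Ky [m mE].
    suff -> : x = y by [].
    apply: (Es_sep x y (inr tt) (inr tt) (m + (w (x 1)).1 - (w (y 1)).1)).
    move: mE; rewrite !preE /q /cross /corr /W /ztrans !scale_pairE/=.
    by rewrite !intrD mulrNz => <-; ring.
have chain pr su : lt = pr ++ su -> shear_chain K
    (fun xi => F (E xi) + pre pr (ab xi)) (map stage su ++ last2).
  elim: su pr => [|s su IH] pr ltE.
    by move: ltE; rewrite cats0 => <-.
  have nths : nth s0 lt (size pr) = s by rewrite ltE nth_cat ltnn subnn.
  have szpr : (size pr < size lt)%N by rewrite ltE size_cat/= addnS ltnS leq_addr.
  have sl : s.1 \in l.
    by rewrite -nths -ltl -(nth_map s0 s0.1)// mem_nth// size_map.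
  case: s IH ltE nths sl => [[sd sa] st] IH ltE nths sl; split => //=.
  - by have [] := l1 _ sl.
  - by move=> xi _; have := lta s0 _ szpr (ab xi); rewrite nths.
  - move=> x y Kx Ky [m mE].
    suff -> : x = y by [].
    pose k : 'I_(size lt).+1 := Ordinal (ltnW szpr : (size pr < (size lt).+1)%N).
    apply: (E_sep x y (inl (k, ab x)) (inl (k, ab y)) m).
    by rewrite /q /= nths ltE take_size_cat.
  have -> : (fun x => F (E x) + pre pr (ab x) + st (ab x) *: ztrans R sd.1 sd.2) =
      (fun x => F (E x) + pre (rcons pr (sd, sa, st)) (ab x)).
    by apply/funext => x; rewrite /pre -cats1 big_cat big_seq1/= addrA.
  by apply: IH; rewrite cat_rcons.
have := chain [::] lt erefl.
have -> : (fun xi : X => F (E xi) + pre [::] (ab xi)) = (fun xi => F (E xi)).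
  by apply/funext => xi; rewrite /pre big_nil addr0.
move=> /(shear_chain_map cK cFE)[h [[hl hm ha] hK hz]].
have hE xi : K xi -> h (F (E xi)) = Es xi + W (xi 1).
  move=> Kxi; rewrite hK// big_cat/= big_map/= -uE !big_cons big_nil/=.
  by rewrite /corr !scale_pairE; congr pair => /=; ring.
exists (h \o F); split.
- case: FH => Fl Fa; split; first exact: lift_homeo0_comp.
  move=> /Fa aF A mA; rewrite comp_preimage aF ?ha//.
  by rewrite -[_ @^-1` _]setTI; exact: hm.
- apply: (@le_lt_trans _ _ (eps' + 7 * eta)); last first.
    by rewrite /eta; move: eps'eps; lra.
  apply: sup_le_ub; first by exists (enorm (F 0 - h (F 0))); exists 0.
  move=> _ [z _ <-] /=; rewrite enormB.
  have := hz (F z); rewrite map_cat -map_comp.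
  rewrite (_ : map _ lt = l)// => /zonogon_cat[w1 [w2 [-> /l2 h1]]] /=.
  move=> [t1 ht1 [t2 ht2 w2E]].
  have -> : w2 = (t1, t2).
    move: w2E => /eqP; rewrite subr_eq0 subr_eq => /eqP ->.
    by rewrite !scale_pairE; congr pair => /=; ring.
  have h2 : enorm ((t1, t2) : P) <= 6 * eta.
    rewrite (le_trans (enorm_le_norm _))// (_ : 6 * eta = 2 * (3 * eta)); last by ring.
    by rewrite ler_wpM2l// pair_norm_le ht1 ht2.
  by rewrite (le_trans (enormD _ _))//; lra.
- move=> n b hb.
  (* Negative times repeat the first letter. Membership in [K] tests the letters at 0 and 1, which
     are those of step [t]. *)
  pose xi (t : nat) : X := fun i : int => b (absz (Num.max (0 : int) (i + t%:Z))).
  have xi0 t : xi t 0 = b t by rewrite /xi add0r max_r.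
  have xi1 t : xi t 1 = b t.+1 by rewrite /xi max_r.
  exists (fun t => E (xi t)); split => [t|t tn].
    by rewrite -xi0 (le_trans (E_c _)).
  rewrite /= hE; last by rewrite /K /= xi0 xi1; exact: hb.
  rewrite xi1; congr (_ + _); rewrite /Es /E; congr e; apply/funext => i.
  by rewrite /xi -addrA -[t.+1]add1n PoszD.
Qed.

End shadowing_map.

(** * Uniform estimates for lifts *)

Section lifts.
Variable R : realType.
Local Notation P := (R * R)%type.

Lemma unit_square_compact : compact ([set` `[0, 1]] `*` [set` `[0, 1]] : set P).
Proof. by apply: compact_setX; exact: segment_compact. Qed.

Lemma unit_square_reduction (z : P) : exists p q : int,
  ([set` `[0, 1]] `*` [set` `[0, 1]] : set P) (z - ztrans R p q).
Proof.
exists (Num.floor z.1), (Num.floor z.2); split; rewrite /= in_itv/=.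
  have := floor_itv z.1; rewrite intrD; lra.
by have := floor_itv z.2; rewrite intrD; lra.
Qed.

Variable F : P -> P.
Hypothesis FL : lift_homeo0 F.

Lemma lift_translate (z : P) (p q : int) : F (z - ztrans R p q) = F z - ztrans R p q.
Proof. by have := FL.2 (z - ztrans R p q) p q; rewrite subrK => ->; rewrite addrK. Qed.

Lemma displacement_bounded : exists2 B, 0 < B & forall z, `|F z - z| <= B.
Proof.
have cF : continuous F by case: FL => -[].
have cD : continuous (fun z => F z - z) by apply: continuous_subT => // x; exact: cvg_id.
have := continuous_compact (continuous_subspaceT cD) unit_square_compact.
move=> /compact_bounded[M [_ hM]]; exists (`|M| + 1); first by rewrite ltr_wpDl.
move=> z; have [p [q sz]] := unit_square_reduction z.
have -> : F z - z = F (z - ztrans R p q) - (z - ztrans R p q).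
  by rewrite lift_translate opprB addrA subrK.
apply: (hM (`|M| + 1)); first by rewrite (le_lt_trans (ler_norm _))// ltrDl.
by exists (z - ztrans R p q).
Qed.

Lemma lift_unif_continuous (eta : R) : 0 < eta -> exists2 delta, 0 < delta &
  forall z z', `|z - z'| <= delta -> `|F z - F z'| <= eta.
Proof.
move=> eta0; have cF : continuous F by case: FL => -[].
have : \forall d \near (0 : R)^'+, forall z,
    ([set` `[0, 1]] `*` [set` `[0, 1]] : set P) z ->
    forall z', `|z - z'| <= d -> `|F z - F z'| <= eta.
  move/compact_near_coveringP : unit_square_compact; apply => z _.
  have : \forall y \near z, `|F y - F z| < eta / 2.
    have cn : continuous (fun y => `|F y - F z|).
      apply: (continuous_compT _ (@norm_continuous R P)).
      by apply: continuous_subT => // x; exact: cvg_cst.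
    have be : `|F z - F z| < eta / 2 by rewrite subrr normr0 divr_gt0.
    exact: (cn z _ (lt_nbhsl be)).
  move=> /nbhs_ballP[rho /= rho0 hrho].
  have hrho' y : `|y - z| < rho -> `|F y - F z| < eta / 2.
    by move=> yz; apply: hrho; rewrite -ball_normE/= distrC.
  have rho20 : 0 < rho / 2 by rewrite divr_gt0.
  exists (ball z (rho / 2), [set d : R | d < rho / 2]).
    by split; [exact: nbhsx_ballx | exact: nbhs_right_lt].
  move=> [y d] [/=]; rewrite -ball_normE/= => yz dr z' yz'.
  rewrite -(subrKA (F z)) (le_trans (ler_normD _ _))// (splitr eta) lerD//.
    by apply/ltW/hrho'; rewrite distrC (lt_trans yz)// ltr_pdivrMr// ltr_pMr// ltr1n.
  rewrite distrC; apply/ltW/hrho'; rewrite -(subrKA y) (le_lt_trans (ler_normD _ _))//.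
  by rewrite (splitr rho) ltrD// distrC// (le_lt_trans yz').
move=> h; have [d [d0 hd]] : exists d : R, 0 < d /\ forall z,
    ([set` `[0, 1]] `*` [set` `[0, 1]] : set P) z ->
    forall z', `|z - z'| <= d -> `|F z - F z'| <= eta.
  by apply: (@filter_ex _ (0 : R)^'+); near=> d; split => //; near: d.
exists d => // z z' zz'; have [p [q sz]] := unit_square_reduction z.
have := hd _ sz (z' - ztrans R p q).
by rewrite !lift_translate !opprB !addrA !subrK; exact.
Unshelve. all: by end_near. Qed.

End lifts.

(** * Coding pseudo-orbits on a finite grid *)

Section pseudo_rotation.
Variable R : realType.
Local Notation P := (R * R)%type.

Lemma cvg_inv_tends (n : nat -> nat) : tends_to_infty n ->
  (fun k => (n k)%:R^-1 : R) @ \oo --> 0.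
Proof.
move=> nty; apply/cvgrPdist_le => /= eps eps0.
have [K hK] := nty (Num.truncn eps^-1).+1.
exists K => // k /= Kk; have nk := hK _ Kk.
rewrite sub0r normrN normfV normr_nat.
have n0 : 0 < (n k)%:R :> R by rewrite ltr0n (leq_trans _ nk).
rewrite -[leRHS]invrK lef_pV2 ?posrE ?invr_gt0//.
by rewrite (le_trans (ltW (truncnS_gt _)))// ler_nat.
Qed.

Lemma cvg_close (n : nat -> nat) (a b : nat -> P) (C : R) (v : P) :
  tends_to_infty n -> (forall k, `|a k - b k| <= C) ->
  (fun k => (n k)%:R^-1 *: b k) @ \oo --> v ->
  (fun k => (n k)%:R^-1 *: a k) @ \oo --> v.
Proof.
move=> nty ab bv.
have -> : (fun k => (n k)%:R^-1 *: a k) =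
    (fun k => (n k)%:R^-1 *: b k + (n k)%:R^-1 *: (a k - b k)).
  by apply/funext => k; rewrite -scalerDr addrC subrK.
rewrite -[v]addr0; apply: cvgD => //.
apply/cvgr0Pnorm_le => eps eps0.
have C0 : 0 < `|C| + 1 by rewrite ltr_wpDl.
have /cvgrPdist_le/(_ (eps / (`|C| + 1))) := cvg_inv_tends nty.
move=> /(_ (divr_gt0 eps0 C0)); apply: filterS => k /=; rewrite sub0r normrN => h.
rewrite normrZ (le_trans (ler_pM _ _ h (ab k)))//.
rewrite mulrAC ler_pdivrMr// ler_pM2l// (le_trans (ler_norm _))// lerDl//.
Qed.

Lemma grid_point (M : nat) (z : P) : (0 < M)%N ->
  exists (a : 'I_M * 'I_M) (V : int * int),
    `|z - (a.1%:R / M%:R, a.2%:R / M%:R) - ztrans R V.1 V.2| <= M%:R^-1.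
Proof.
move=> M0; have M0' : 0 < M%:R :> R by rewrite ltr0n.
have coord (x : R) : exists (i : 'I_M) (m : int), `|x - i%:R / M%:R - m%:~R| <= M%:R^-1.
  pose y := x - (Num.floor x)%:~R.
  have /andP[y0 y1] : 0 <= y < 1.
    by have := floor_itv x; rewrite intrD /y; lra.
  have yM : 0 <= M%:R * y by rewrite mulr_ge0// ltW.
  have /andP[i1 i2] : (Num.truncn (M%:R * y))%:R <= M%:R * y <
    (Num.truncn (M%:R * y)).+1%:R by exact: truncn_itv.
  have iM : (Num.truncn (M%:R * y) < M)%N.
    by rewrite -(ltr_nat R) (le_lt_trans i1)// gtr_pMr.
  exists (Ordinal iM), (Num.floor x) => /=; move: i1 i2.
  set i := Num.truncn _; rewrite -natr1 => i1 i2.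
  rewrite (_ : _ - _ = y - i%:R / M%:R); last by rewrite /y; ring.
  have i1' : i%:R / M%:R <= y by rewrite ler_pdivrMr// mulrC.
  rewrite ger0_norm ?subr_ge0// lerBlDr.
  rewrite (_ : _ + _ = (i%:R + 1) / M%:R); last by rewrite mulrDl mul1r addrC.
  by rewrite ler_pdivlMr// mulrC ltW.
have [i1 [m1 h1]] := coord z.1; have [i2 [m2 h2]] := coord z.2.
by exists (i1, i2), (m1, m2); rewrite pair_norm_le/= h1 h2.
Qed.

Lemma inord_absz_shift (L : nat) (m : int) : `|m| <= L%:Z ->
  (inord (absz (m + L%:Z)) : 'I_(L.*2).+1)%:Z - L%:Z = m.
Proof.
move=> mL; have mL0 : 0 <= m + L%:Z by lia.
by rewrite inordK ?gez0_abs//; lia.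
Qed.

(** [G] is chosen before the pseudo-orbit and its length. A bounded error suffices, since division
    by [n] makes it disappear in rotation vectors. *)
Lemma pseudo_orbits_shadowed (area : bool) (F : P -> P) (eps e : R) :
  in_H area F -> 0 < e -> e < eps ->
  exists G, [/\ in_H area G, dC0 F G < eps &
    forall x n, pseudo_orbit F e x n ->
      exists z, `|(iter n G z - z) - (x n - x 0%N)| <= 4].
Proof.
move=> FH e0 eeps; have FL : lift_homeo0 F by case: FH.
pose eta := (eps - e) / 8.
have eta0 : 0 < eta by rewrite divr_gt0// subr_gt0.
have [dl dl0 hdl] := lift_unif_continuous FL eta0.
have [B B0 hB] := displacement_bounded FL.
pose d := Num.min (Num.min dl eta) 1.
have d0 : 0 < d by rewrite !lt_min dl0 eta0 ltr01.
pose M := (Num.truncn d^-1).+1.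
have Md : M%:R^-1 <= d.
  by rewrite -[leRHS]invrK lef_pV2 ?posrE ?invr_gt0 ?ltr0n// ltW// truncnS_gt.
have /andP[/andP[ddl deta] d1] : (d <= dl) && (d <= eta) && (d <= 1).
  by rewrite !ge_min !lexx ?orbT.
pose L := (Num.truncn (B + e + 3)).+1.
have LB : B + e + 3 < L%:R by exact: truncnS_gt.
pose T : finType := (('I_M * 'I_M) * ('I_(L.*2).+1 * 'I_(L.*2).+1))%type.
pose c (t : T) : P := (t.1.1%:R / M%:R, t.1.2%:R / M%:R).
pose w (t : T) : int * int := (t.2.1%:Z - L%:Z, t.2.2%:Z - L%:Z).
(* Passing to the grid costs [eta] in the sup norm at each end of a step, and [enorm] is at most
   twice that norm. *)
have eps1 : e + 4 * eta < eps by rewrite /eta; lra.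
have eps10 : 0 < e + 4 * eta by lra.
have [G [GH dG hG]] := shadowing_map FH eps10 eps1 c w ltr01.
exists G; split => // x n xF.
have [a aP] := choice (fun t => grid_point (x t) (ltn0Sn _ : (0 < M)%N)).
have [V VP] := choice aP.
pose Vz t := ztrans R (V t).1 (V t).2.
pose enc (m : int) : 'I_(L.*2).+1 := inord (absz (m + L%:Z)).
pose b t : T := if t is t'.+1
  then (a t, (enc ((V t).1 - (V t').1), enc ((V t).2 - (V t').2)))
  else (a t, (enc 0, enc 0)).
have b1 t : (b t).1 = a t by case: t.
have cb t : `|x t - c (b t) - Vz t| <= d by rewrite /c b1 (le_trans (VP t)).
have wb t : (t < n)%N -> ztrans R (w (b t.+1)).1 (w (b t.+1)).2 = Vz t.+1 - Vz t.
  move=> tn.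
  have Vd : `|Vz t.+1 - Vz t| <= L%:R.
    have -> : Vz t.+1 - Vz t = (F (x t) - x t) - (F (x t) - x t.+1)
        - (x t.+1 - c (b t.+1) - Vz t.+1) + (x t - c (b t) - Vz t)
        - (c (b t.+1) - c (b t)) by congr pair => /=; ring.
    have h1 := hB (x t).
    have h2 := le_trans (norm_le_enorm _) (ltW (xF t tn)).
    have h3 := cb t; have h4 := cb t.+1.
    have c01 (i : 'I_M) : 0 <= (i%:R / M%:R : R) <= 1.
      have M0 : 0 < M%:R :> R by rewrite ltr0n.
      apply/andP; split; first exact: divr_ge0.
      by rewrite (ler_pdivrMr _ _ M0) mul1r ler_nat ltnW.
    have h5 : `|c (b t.+1) - c (b t)| <= 1.
      rewrite pair_norm_le/=.
      have := c01 (b t.+1).1.1; have := c01 (b t.+1).1.2.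
      have := c01 (b t).1.1; have := c01 (b t).1.2.
      by rewrite !ler_norml; lra.
    rewrite (le_trans (ler_normB _ _))//.
    have t1 := ler_normD ((F (x t) - x t) - (F (x t) - x t.+1)
        - (x t.+1 - c (b t.+1) - Vz t.+1)) (x t - c (b t) - Vz t).
    have t2 := ler_normB ((F (x t) - x t) - (F (x t) - x t.+1))
        (x t.+1 - c (b t.+1) - Vz t.+1).
    have t3 := ler_normB (F (x t) - x t) (F (x t) - x t.+1).
    lra.
  have encK (m : int) : `|m%:~R : R| <= L%:R -> (enc m)%:Z - L%:Z = m.
    by rewrite -intr_norm pmulrn ler_int; exact: inord_absz_shift.
  move: Vd; rewrite pair_norm_le/= -!intrB => /andP[v1 v2].
  by rewrite !encK// /Vz /ztrans !intrB.
have edges t : (t < n)%N -> enorm (F (c (b t)) - c (b t.+1) -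
    ztrans R (w (b t.+1)).1 (w (b t.+1)).2) <= e + 4 * eta.
  move=> tn; rewrite wb//.
  have FcV : F (c (b t) + Vz t) = F (c (b t)) + Vz t by exact: FL.2.
  have -> : F (c (b t)) - c (b t.+1) - (Vz t.+1 - Vz t) =
      (F (c (b t) + Vz t) - F (x t)) + (F (x t) - x t.+1) +
      (x t.+1 - c (b t.+1) - Vz t.+1).
    by rewrite FcV; congr pair => /=; ring.
  have h1 : `|F (c (b t) + Vz t) - F (x t)| <= eta.
    apply: hdl; rewrite distrC opprD addrA; exact: le_trans (cb t) ddl.
  have h2 := xF t tn; have h3 := le_trans (cb t.+1) deta.
  have t1 := enormD ((F (c (b t) + Vz t) - F (x t)) + (F (x t) - x t.+1))
    (x t.+1 - c (b t.+1) - Vz t.+1).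
  have t2 := enormD (F (c (b t) + Vz t) - F (x t)) (F (x t) - x t.+1).
  have t3 := enorm_le_norm (F (c (b t) + Vz t) - F (x t)).
  have t4 := enorm_le_norm (x t.+1 - c (b t.+1) - Vz t.+1).
  lra.
have [z [zc zG]] := hG n b edges.
have iterE t : (t <= n)%N -> iter t G (z 0%N) = z t + (Vz t - Vz 0%N).
  elim: t => [|t IH] tn; first by rewrite subrr addr0.
  have VE : Vz t - Vz 0%N = ztrans R ((V t).1 - (V 0%N).1) ((V t).2 - (V 0%N).2).
    by rewrite /Vz /ztrans !intrB.
  rewrite iterS IH ?(ltnW tn)// VE GH.1.2 -VE zG// wb//.
  by congr pair => /=; ring.
exists (z 0%N); rewrite iterE//.
have -> : z n + (Vz n - Vz 0%N) - z 0%N - (x n - x 0%N) =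
    ((z n - c (b n)) - (x n - c (b n) - Vz n)) -
    ((z 0%N - c (b 0%N)) - (x 0%N - c (b 0%N) - Vz 0%N)).
  by congr pair => /=; ring.
have t1 := ler_normB ((z n - c (b n)) - (x n - c (b n) - Vz n))
  ((z 0%N - c (b 0%N)) - (x 0%N - c (b 0%N) - Vz 0%N)).
have t2 := ler_normB (z n - c (b n)) (x n - c (b n) - Vz n).
have t3 := ler_normB (z 0%N - c (b 0%N)) (x 0%N - c (b 0%N) - Vz 0%N).
have := zc n; have := zc 0%N; have := cb n; have := cb 0%N; lra.
Qed.

Lemma rot_set_eps_sub (area : bool) (F : P -> P) (eps e : R) :
  in_H area F -> upper_stable area F eps -> 0 < e -> e < eps ->
  rot_set_eps F e `<=` rot_set F.
Proof.
move=> FH Fst e0 eeps v [x [n [nty [xF xv]]]].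
have [G [GH dG hG]] := pseudo_orbits_shadowed FH e0 eeps.
apply: (Fst G GH dG).
have [z zP] := choice (fun k => hG (x k) (n k) (xF k)).
by exists z, n; split => //; exact: cvg_close nty zP xv.
Qed.

End pseudo_rotation.

(** * Disc packing *)

Section disc_area.
Variable R : realType.
Local Notation P := (R * R)%type.
Local Notation mu := (@lebesgue_measure R).

Definition disc (a : P) (r : R) : set P := [set z | enorm (z - a) < r].

(** A primitive of the chord length of the disc; the interval is open because [asin] is not
    differentiable at its end points. *)
Lemma is_derive_half_disc (r x : R) : 0 < r -> - r < x < r ->
  is_derive x 1 (fun x => x * Num.sqrt (r ^+ 2 - x ^+ 2) + r ^+ 2 * asin (x / r))
    (2 * Num.sqrt (r ^+ 2 - x ^+ 2)).
Proof.
move=> r0 /andP[rx xr].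
have s0 : 0 < r ^+ 2 - x ^+ 2.
  rewrite subr_sqr mulr_gt0//; lra.
have d1 : is_derive x 1 (fun x : R => r ^+ 2 - x ^+ 2) (- (2 * x)).
  have -> : (fun x : R => r ^+ 2 - x ^+ 2) = cst (r ^+ 2) - (@id R) ^+ 2.
    by apply/funext => y /=; rewrite !fctE.
  by apply: is_derive_eq; rewrite /= expr1 scaler1 /GRing.scale/= mulr2n; ring.
have d2 : is_derive x 1 (Num.sqrt \o (fun x : R => r ^+ 2 - x ^+ 2))
    ((2 * Num.sqrt (r ^+ 2 - x ^+ 2))^-1 * (- (2 * x))).
  by apply: is_derive1_comp; exact: is_derive1_sqrt.
have xr1 : -1 < x / r < 1 by rewrite ltr_pdivlMr// ltr_pdivrMr// mulN1r mul1r rx.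
have d3 : is_derive x 1 (fun x : R => x / r) (r^-1).
  have -> : (fun x : R => x / r) = r^-1 \*: (@id R).
    by apply/funext => y /=; rewrite /GRing.scale/= mulrC.
  by apply: is_derive_eq; rewrite /GRing.scale/= mulr1.
have d4 : is_derive x 1 (@asin R \o (fun x => x / r))
    ((Num.sqrt (1 - (x / r) ^+ 2))^-1 * r^-1).
  by apply: is_derive1_comp; exact: is_derive1_asin.
have -> : (fun x => x * Num.sqrt (r ^+ 2 - x ^+ 2) + r ^+ 2 * asin (x / r)) =
    (@id R) * (Num.sqrt \o (fun x : R => r ^+ 2 - x ^+ 2)) +
    (r ^+ 2) \*: (@asin R \o (fun x => x / r)).
  by apply/funext => y; rewrite !fctE /= /GRing.scale.
apply: is_derive_eq.
rewrite /GRing.scale/=.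
have -> : Num.sqrt (1 - (x / r) ^+ 2) = Num.sqrt (r ^+ 2 - x ^+ 2) / r.
  have -> : 1 - (x / r) ^+ 2 = (r ^+ 2 - x ^+ 2) * (r^-1) ^+ 2 by field; rewrite gt_eqF.
  by rewrite sqrtrM ?ltW// sqrtr_sqr gtr0_norm// invr_gt0.
have := sqr_sqrtr (ltW s0).
have : 0 < Num.sqrt (r ^+ 2 - x ^+ 2) by rewrite sqrtr_gt0.
set s := Num.sqrt _ => sp sE.
have -> : x * ((2 * s)^-1 * - (2 * x)) + s * 1 + r ^+ 2 * ((s / r)^-1 / r) =
    (r ^+ 2 - x ^+ 2) / s + s by field; rewrite !gt_eqF.
by rewrite -sE; field; rewrite gt_eqF.
Qed.

Lemma measurable_disc (a : P) (r : R) : 0 < r -> measurable (disc a r).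
Proof.
move=> r0.
have -> : disc a r = (fun z : P => (z.1 - a.1) ^+ 2 + (z.2 - a.2) ^+ 2) @^-1`
    `]-oo, (r ^+ 2)[.
  apply/seteqP; split=> z; rewrite /disc /= in_itv/= -(@ltr_sqr _ (enorm _)) ?nnegrE
    ?enorm_ge0 ?(ltW r0)// sqr_enorm /dot -!expr2//.
rewrite -[_ @^-1` _]setTI.
have mf : measurable_fun setT (fun z : P => (z.1 - a.1) ^+ 2 + (z.2 - a.2) ^+ 2).
  apply: measurable_funD; apply: measurable_funX; apply: measurable_funB => //.
by apply: mf.
Qed.

Lemma leb2_translate (a : P) (A : set P) : measurable A ->
  leb2 ((fun z => z - a) @^-1` A) = leb2 A.
Proof.
move=> mA.
have -> : (fun z => z - a) @^-1` A =
    vshear (fun=> - a.2) @^-1` (hshear (fun=> - a.1) @^-1` A).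
  by apply/seteqP; split=> z.
rewrite leb2_vshear ?leb2_hshear//.
by rewrite -[_ @^-1` _]setTI; apply: measurable_hshear.
Qed.

Lemma leb2_disc_center (a : P) (r : R) : 0 < r -> leb2 (disc a r) = leb2 (disc 0 r).
Proof.
move=> r0; have E : disc a r = (fun z => z - a) @^-1` disc 0 r.
  by apply/seteqP; split=> z; rewrite /disc /= subr0.
by rewrite E; exact: (leb2_translate a (measurable_disc 0 r0)).
Qed.

Lemma leb2_disc_ge (a : P) (r : R) : 0 < r ->
  ((pi * r ^+ 2)%:E <= leb2 (disc a r))%E.
Proof.
move=> r0; rewrite leb2_disc_center//.
pose f (x : R) : R := 2 * Num.sqrt (r ^+ 2 - x ^+ 2).
have sec x : mu (xsection (disc 0 r) x) = (f x)%:E.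
  rewrite (_ : xsection _ _ =
    [set` `](- Num.sqrt (r ^+ 2 - x ^+ 2)), (Num.sqrt (r ^+ 2 - x ^+ 2))[]); last first.
    apply/seteqP; split=> y; rewrite /xsection /= in_setE /disc /= subr0 in_itv/= -ltr_norml.
      rewrite -ltr_sqr ?nnegrE ?enorm_ge0 ?(ltW r0)// sqr_enorm /dot/= -!expr2 => h.
      by have y2 := sqr_ge0 y; rewrite -sqrtr_sqr ltr_sqrt; lra.
    move=> h; have s0 : 0 < Num.sqrt (r ^+ 2 - x ^+ 2) by exact: le_lt_trans h.
    rewrite sqrtr_gt0 in s0; move: h; rewrite -sqrtr_sqr ltr_sqrt// => h.
    by rewrite -ltr_sqr ?nnegrE ?enorm_ge0 ?(ltW r0)// sqr_enorm /dot/= -!expr2; lra.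
  rewrite lebesgue_measure_itv/= lte_fin /f; have := sqrtr_ge0 (r ^+ 2 - x ^+ 2).
  set s := Num.sqrt _; case: ifPn => [_ _|]; first by rewrite -EFinB; congr EFin; ring.
  by rewrite -leNgt => h1 h2; congr EFin; lra.
have cf : continuous f.
  apply: continuous_mulT => x; first exact: cvg_cst.
  apply: (@continuous_compT _ _ _ (fun x : R => r ^+ 2 - x ^+ 2)); last exact: sqrt_continuous.
  apply: continuous_subT => y; first exact: cvg_cst.
  by apply: (@continuous_mulT R _ id id) => z; exact: cvg_id.
have leb2E : leb2 (disc 0 r) = (\int[mu]_x (f x)%:E)%E.
  by apply: eq_integral => x _ /=; rewrite sec.
(* Integrating over [[- r sin t, r sin t]] avoids the singular ends of the primitive. Its first term
   contributes a nonnegative amount, which is dropped, and [t] then tends to [pi / 2]. *)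
have key (t : R) : 0 < t < pi / 2 -> ((2 * r ^+ 2 * t)%:E <= leb2 (disc 0%R r))%E.
  move=> /andP[t0 tpi].
  have tI : t \in `[(- (pi / 2)), (pi / 2)] by rewrite in_itv/=; lra.
  have st : 0 < sin t by apply: sin_gt0_pihalf; rewrite t0.
  have ct : 0 < cos t by apply: cos_gt0_pihalf; lra.
  have st1 : sin t < 1.
    rewrite -ltr_sqr ?nnegrE ?(ltW st)// expr1n -(cos2Dsin2 t) ltrDr.
    by rewrite exprn_gt0.
  pose a' := r * sin t.
  have a'0 : 0 < a' by rewrite mulr_gt0.
  have a'r : a' < r by rewrite gtr_pMr.
  pose G (x : R) := x * Num.sqrt (r ^+ 2 - x ^+ 2) + r ^+ 2 * asin (x / r).
  have dG x : - r < x < r -> is_derive x 1 G (f x) by exact: is_derive_half_disc.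
  have cG x : - r < x < r -> {for x, continuous G}.
    move=> xr; apply: differentiable_continuous; apply/derivable1_diffP.
    exact: (@ex_derive _ _ _ _ _ _ _ (dG x xr)).
  have : (\int[mu]_(x in `[(- a')%R, a']) (f x)%:E <= leb2 (disc 0%R r))%E.
    rewrite leb2E; apply: ge0_subset_integral => //.
      apply/measurable_EFinP; exact: continuous_measurable_fun.
    by move=> x _; rewrite lee_fin mulr_ge0 ?sqrtr_ge0.
  apply: le_trans.
  rewrite (@continuous_FTC2 _ f G (- a') a'); first last.
  - move=> x; rewrite in_itv/= => xa; rewrite derive1E.
    by apply: (@derive_val _ _ _ _ _ _ _ (dG x _)); lra.
  - split.
    + move=> x; rewrite in_itv/= => xa.
      by apply: (@ex_derive _ _ _ _ _ _ _ (dG x _)); lra.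
    + by apply: cvg_at_right_filter; apply: cG; lra.
    + by apply: cvg_at_left_filter; apply: cG; lra.
  - exact: continuous_subspaceT.
  - lra.
  have asa : asin (a' / r) = t by rewrite /a' mulrAC divff ?gt_eqF// mul1r sinK.
  have asNa : asin (- a' / r) = - t.
    rewrite mulNr /a' mulrAC divff ?gt_eqF// mul1r -sinN sinK// in_itv/=; lra.
  rewrite -EFinB lee_fin /G asa asNa sqrrN.
  have : 0 <= a' * Num.sqrt (r ^+ 2 - a' ^+ 2) by rewrite mulr_ge0 ?sqrtr_ge0// ltW.
  lra.
have pi2 : 0 < pi / 2 :> R by rewrite divr_gt0 ?pi_gt0.
case: (leb2 (disc 0 r)) key => [v| |] key; last 2 first.
- by rewrite leey.
- by have := key (pi / 4); rewrite leeNy_eq/=; apply; have p0 := pi_gt0 R; lra.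
rewrite lee_fin leNgt; apply/negP => h.
have r20 : 0 < r ^+ 2 by rewrite exprn_gt0.
have h0 : 0 < v.
  have p4 : 0 < (pi / 4 : R) < pi / 2 by have p0 := pi_gt0 R; lra.
  have := key _ p4; rewrite lee_fin; apply: lt_le_trans.
  by rewrite mulr_gt0 ?(andP p4).1// mulr_gt0.
pose t := (v / (2 * r ^+ 2) + pi / 2) / 2.
have vt : v / (2 * r ^+ 2) < pi / 2 by rewrite ltr_pdivrMr ?mulr_gt0//; lra.
have v0 : 0 < v / (2 * r ^+ 2) by rewrite divr_gt0// mulr_gt0.
have t0 : 0 < t < pi / 2 by rewrite /t; lra.
have := key t t0; rewrite lee_fin leNgt => /negP; apply.
by rewrite mulrC -ltr_pdivrMr ?mulr_gt0// /t; lra.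
Qed.

End disc_area.

(** * Counting points separated modulo Z^2 *)

Section packing.
Variable R : realType.
Local Notation P := (R * R)%type.
Local Notation mu := (@lebesgue_measure R).

Definition zseparated (c : R) (s : seq P) := forall i j : nat,
  (i < j < size s)%N -> forall p q : int,
  c <= enorm (nth 0 s j - nth 0 s i - ztrans R p q).

Lemma enorm_ztrans_ge1 (p q : int) : (p, q) != (0, 0) -> 1 <= enorm (ztrans R p q).
Proof.
move=> pq; apply: le_trans (norm_le_enorm _).
have int1 (m : int) : m != 0 -> 1 <= `|m%:~R : R|.
  by move=> m0; rewrite -intr_norm (ler_int R 1) -gtz0_ge1 normr_gt0.
rewrite prod_normE/= le_max; move: pq; rewrite xpair_eqE negb_and.
by case/orP => /int1 ->; rewrite ?orbT.
Qed.

(** Counting takes place in the plane, with [m ^ 2] translates of each disc. Translates of one disc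
    are disjoint because [c <= 1], and a margin of 1 on each side of the box contains the discs that
    stick out. *)
Lemma packing_box (c : R) (s : seq P) (m : nat) : 0 < c -> c <= 1 ->
  zseparated c s -> (forall i, 0 <= (nth 0 s i).1 < 1 /\ 0 <= (nth 0 s i).2 < 1) ->
  (size s)%:R * m%:R ^+ 2 * (pi * (c / 2) ^+ 2) <= (m%:R + 2) ^+ 2.
Proof.
move=> c0 c1 sep s01.
have c20 : 0 < c / 2 by rewrite divr_gt0.
pose I : finType := ('I_(size s) * ('I_m * 'I_m))%type.
pose ctr (k : I) : P := nth 0 s k.1 + ztrans R k.2.1%:Z k.2.2%:Z.
have ctr_sep (k k' : I) : k != k' -> c <= enorm (ctr k - ctr k').
  wlog kk : k k' / (k'.1 <= k.1)%N.
    move=> h kk'; have [/h|/ltnW/h] := leqP k'.1 k.1; first exact.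
    by rewrite enormB eq_sym; exact.
  move=> kk'.
  have E : ctr k - ctr k' = nth 0 s k.1 - nth 0 s k'.1 -
      ztrans R (k'.2.1%:Z - k.2.1%:Z) (k'.2.2%:Z - k.2.2%:Z).
    by rewrite /ctr /ztrans !intrB; congr pair => /=; ring.
  move: kk; rewrite leq_eqVlt => /predU1P[kk|kk]; last first.
    by rewrite E; apply: sep; rewrite kk/=.
  rewrite E kk subrr sub0r enormN (le_trans c1)// enorm_ztrans_ge1//.
  apply: contra kk' => /eqP[h1 h2].
  case: k k' kk h1 h2 {E} => [k1 [k2 k3]] [k1' [k2' k3']] /= kk h1 h2.
  rewrite !xpair_eqE -!val_eqE/=; lia.
pose D (j : 'I_#|I|) := disc (ctr (enum_val j)) (c / 2).
have mD j : measurable (D j) by exact: measurable_disc.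
have tD : trivIset setT D.
  move=> j j' _ _ [z [zj zj']]; apply/eqP/contraT => jj'.
  have : enum_val j != enum_val j' by rewrite (inj_eq enum_val_inj).
  move/ctr_sep; rewrite leNgt => /negP; case.
  have -> : ctr (enum_val j) - ctr (enum_val j') =
    (z - ctr (enum_val j')) - (z - ctr (enum_val j)) by congr pair => /=; ring.
  have := enormD (z - ctr (enum_val j')) (- (z - ctr (enum_val j))); rewrite enormN.
  by move: zj zj'; rewrite /D /disc /=; lra.
pose box : set P := [set` `[(-1 : R), (m%:R + 1)]] `*` [set` `[(-1 : R), (m%:R + 1)]].
have mbox : measurable box by exact: measurableX.
have Dbox : \big[setU/set0]_(j < #|I|) D j `<=` box.
  rewrite -bigcup_seq => z [j _ zj].
  have := le_lt_trans (norm_le_enorm _) zj; set k := enum_val j in zj *.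
  move=> /ltW; rewrite pair_norm_le /ctr /= !ler_norml.
  have h1 : (k.2.1%:R : R) + 1 <= m%:R by rewrite natr1 ler_nat.
  have h2 : (k.2.2%:R : R) + 1 <= m%:R by rewrite natr1 ler_nat.
  have h3 : 0 <= k.2.1%:R :> R by [].
  have h4 : 0 <= k.2.2%:R :> R by [].
  have [h5 h6] := s01 k.1.
  by move=> h7; split; rewrite /= in_itv/=; lra.
pose l2 := (mu \x mu)%E.
have : (l2 (\big[setU/set0]_(j < #|I|) D j) <= l2 box)%E.
  apply: (le_measure (mu \x mu)%E) => //; rewrite inE; last exact: mbox.
  by apply: bigsetU_measurable => j _; exact: mD.
rewrite /l2 (measure_bigsetU_ord (mu \x mu)%E xpredT mD tD).
have -> : (mu \x mu)%E box = ((m%:R + 2) ^+ 2)%:E.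
  rewrite product_measure1E//= !lebesgue_measure_itv/= !lte_fin ifT; last first.
    by have := ler0n R m; lra.
  by rewrite -EFinB -EFinM; congr EFin; ring.
move=> hle; rewrite -lee_fin; apply: le_trans hle.
apply: (@le_trans _ _ (\sum_(j < #|I|) (pi * (c / 2) ^+ 2)%:E)%E).
  rewrite sumEFin lee_fin sumr_const card_ord /I !card_prod !card_ord.
  by rewrite -[leRHS]mulr_natl !natrM -expr2.
by apply: lee_sum => j _; exact: leb2_disc_ge.
Qed.

Lemma packing (c : R) (s : seq P) : 0 < c -> c <= 1 -> zseparated c s ->
  (size s)%:R <= 4 / (pi * c ^+ 2).
Proof.
move=> c0 c1 sep.
pose fl (z : P) : P := z - ztrans R (Num.floor z.1) (Num.floor z.2).
pose s' := map fl s.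
have fl01 (z : P) : 0 <= (fl z).1 < 1 /\ 0 <= (fl z).2 < 1.
  by have := floor_itv z.1; have := floor_itv z.2; rewrite !intrD /=; lra.
have s'01 i : 0 <= (nth 0 s' i).1 < 1 /\ 0 <= (nth 0 s' i).2 < 1.
  have [il|il] := ltnP i (size s); first by rewrite (nth_map 0).
  by rewrite nth_default ?size_map//= lexx ltr01.
have sep' : zseparated c s'.
  move=> i j; rewrite size_map => ij p q; have /andP[h1 h2] := ij.
  rewrite !(nth_map 0) ?(ltn_trans h1)// /fl.
  set zi := nth 0 s i; set zj := nth 0 s j.
  have := sep i j ij (p + Num.floor zj.1 - Num.floor zi.1)
                     (q + Num.floor zj.2 - Num.floor zi.2).
  rewrite -/zi -/zj; set A := (X in _ <= enorm X -> _); set B := (X in _ -> _ <= enorm X).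
  suff -> : A = B by [].
  by rewrite /A /B /ztrans !intrD !mulrNz; congr pair => /=; ring.
pose A := (size s)%:R * (pi * (c / 2) ^+ 2).
have hA m : A * m%:R ^+ 2 <= (m%:R + 2) ^+ 2.
  by have := packing_box m c0 c1 sep' s'01; rewrite size_map /A mulrAC.
suff A1 : A <= 1.
  rewrite ler_pdivlMr ?mulr_gt0 ?pi_gt0 ?exprn_gt0//.
  by move: A1; rewrite /A; lra.
rewrite leNgt; apply/negP => A1.
(* With [m (A - 1) > 8] and [m >= 1], [A m^2] exceeds [m^2 + 8 m], hence [(m + 2)^2]. *)
pose m := (Num.truncn (8 / (A - 1))).+1.
have Am : 8 < m%:R * (A - 1).
  by rewrite -ltr_pdivrMr ?subr_gt0//; exact: truncnS_gt.
have m1 : 1 <= m%:R :> R by rewrite ler1n.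
have := hA m; rewrite leNgt => /negP; apply.
nra.
Qed.

End packing.

(** * Last-return decomposition *)

Section chains.
Variable R : realType.
Local Notation P := (R * R)%type.
Variable F : P -> P.
Hypothesis FL : lift_homeo0 F.

Definition reach (e : R) (n : nat) (x y : P) :=
  exists z : nat -> P, [/\ z 0%N = x, z n = y & pseudo_orbit F e z n].

Lemma reach_trans e n m x y w :
  reach e n x y -> reach e m y w -> reach e (n + m) x w.
Proof.
move=> [z [z0 zn hz]] [z' [z'0 z'm hz']].
exists (fun i => if (i < n)%N then z i else z' (i - n)%N); split.
- by case: ltnP => // n0; rewrite sub0n z'0 -zn -z0; move: n0; rewrite leqn0 => /eqP ->.
- by rewrite ltnNge leq_addr/= addKn.
- move=> i im; case: ltnP => [i_n|ni].
    case: ltnP => [_|ni]; first exact: hz.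
    have -> : n = i.+1 by apply/eqP; rewrite eqn_leq ni.
    rewrite subnn z'0 -zn (_ : n = i.+1); first exact: hz.
    by apply/eqP; rewrite eqn_leq ni.
  rewrite ltnNge leqW//= subSn//; apply: hz'.
  by rewrite ltn_subLR.
Qed.

Lemma reach_ztrans e n x y (p q : int) :
  reach e n x y -> reach e n (x + ztrans R p q) (y + ztrans R p q).
Proof.
move=> [z [z0 zn hz]]; exists (fun i => z i + ztrans R p q); split.
- by rewrite z0.
- by rewrite zn.
- by move=> i i_n; rewrite FL.2 opprD addrACA subrr addr0; exact: hz.
Qed.

Lemma ztransMn (m : nat) (p q : int) :
  m%:R *: ztrans R p q = ztrans R (m%:Z * p) (m%:Z * q).
Proof. by rewrite scale_pairE /ztrans !intrM. Qed.

Lemma reach_loop e p x (a b : int) m : reach e p x (x + ztrans R a b) ->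
  reach e (m * p) x (x + m%:R *: ztrans R a b).
Proof.
move=> h; elim: m => [|m IH].
  by exists (fun=> x); split => //; rewrite scale0r addr0.
rewrite mulSn addnC -natr1 scalerDl scale1r addrA.
apply: reach_trans IH _; rewrite ztransMn addrAC.
exact: reach_ztrans.
Qed.

Section orbit.
Variables (x : nat -> P) (d0 c : R).
Hypotheses (d00 : 0 <= d0) (c0 : 0 < c).
Hypothesis x_jump : forall i, enorm (F (x i) - x i.+1) <= d0.

Let e := d0 + c.

Lemma reach_segment i k : reach e k (x i) (x (i + k)%N).
Proof.
exists (fun t => x (i + t)%N); split; rewrite ?addn0// => t _.
by rewrite addnS (le_lt_trans (x_jump _))// /e ltrDl.
Qed.

Definition zclose (z z' : P) := exists p q : int, enorm (z' - z - ztrans R p q) < c.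

(** Redirecting the last jump to a translate of [x a] costs at most [c] and closes a loop, which may
    be repeated [m] times before the original segment is run once more. An empty segment gets
    [W = 0]. *)
Lemma zclose_loop a k : zclose (x a) (x (a + k)%N) ->
  exists W : int * int, [/\ k = 0%N -> W = (0, 0),
    enorm (x (a + k)%N - x a - ztrans R W.1 W.2) <= c &
    forall m, reach e (m * k + k) (x a) (x (a + k)%N + m%:R *: ztrans R W.1 W.2)].
Proof.
case: k => [_|k [p [q pq]]].
  exists (0, 0); split => //.
    rewrite addn0 subrr sub0r enormN (_ : ztrans R _ _ = 0) ?enorm0 ?ltW//.
  move=> m; rewrite muln0 !addn0 (_ : ztrans R _ _ = 0)// scaler0 addr0.
  by exists (fun=> x a).
exists (p, q); split => //; first exact: ltW.
move=> m; apply: (@reach_trans _ _ _ _ (x a + m%:R *: ztrans R p q)); last first.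
  by rewrite ztransMn; apply: reach_ztrans; exact: reach_segment.
apply: reach_loop.
exists (fun t => if (t < k.+1)%N then x (a + t)%N else x a + ztrans R p q); split.
- by rewrite /= addn0.
- by rewrite ltnn.
- move=> t tk; rewrite tk; case: ltnP => tk'.
    by rewrite addnS (le_lt_trans (x_jump _))// /e ltrDl.
  have -> : t = k by apply/eqP; rewrite eqn_leq -ltnS tk.
  have -> : F (x (a + k)%N) - (x a + ztrans R p q) =
      (F (x (a + k)%N) - x (a + k).+1) + (x (a + k).+1 - x a - ztrans R p q).
    by congr pair => /=; ring.
  apply: (le_lt_trans (enormD _ _)); apply: ler_ltD; first exact: x_jump.
  by rewrite -addnS.
Qed.

(** [p] counts the steps inside the loops and [W] adds up their translations; [size s - 1] steps
    link successive loops. Each loop costs [c], each link [d0 + D]. No later point is close to [x a]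
    after its last return, which gives the separation. [V] is quantified last because [W / p], known
    only after the decomposition, will be used. *)
Lemma last_return_decomposition (D : R) (n k a : nat) : n = (a + k)%N ->
  exists (s : seq P) (p : nat) (W : int * int), [/\ zseparated c s /\
      (forall j, (j < size s)%N -> exists i, (a <= i <= n)%N /\ nth 0 s j = x i),
    (p + size s = k.+1)%N /\ (0 < size s)%N,
    p = 0%N -> W = (0, 0),
    forall m, reach e (m * p + k) (x a) (x n + m%:R *: ztrans R W.1 W.2) &
    forall V, (forall z, enorm (F z - z - V) <= D) ->
      enorm (x n - x a - ztrans R W.1 W.2 - (size s).-1%:R *: V)
        <= (size s)%:R * (c + d0 + D)].
Proof.
move: k a; elim/ltn_ind => k IH a nE.
have close0 : zclose (x a) (x (a + 0)%N).
  by exists 0, 0; rewrite addn0 subrr sub0r enormN (_ : ztrans R _ _ = 0) ?enorm0.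
pose Q j := (j <= k)%N && `[< zclose (x a) (x (a + j)%N) >].
have exQ : exists j, Q j by exists 0%N; apply/andP; split => //; exact/asboolP.
have Qk j : Q j -> (j <= k)%N by case/andP.
case: (ex_maxnP exQ Qk) => j /andP[jk /asboolP jclose] jmax.
have [W1 [W10 W1c W1r]] := zclose_loop jclose.
have Dge (V : P) : (forall z, enorm (F z - z - V) <= D) -> 0 <= D.
  by move/(_ 0); apply: le_trans; exact: enorm_ge0.
(* If the last return is at the end, the whole segment is a single loop and the list stops. *)
move: jk; rewrite leq_eqVlt => /predU1P[jk|jk].
  exists [:: x a], k, W1; rewrite nE -jk; split => //.
  - split; first by move=> i i' /=; lia.
    by move=> [|//] _; exists a; rewrite leqnn leq_addr.
  - by rewrite addn1.
  - move=> V /Dge D0; by rewrite scale0r subr0 mul1r (le_trans W1c)// -addrA lerDl addr_ge0.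
have k' : (k - j.+1 < k)%N by lia.
have nE' : n = (a + j.+1 + (k - j.+1))%N by lia.
have [s [p [W [[sep sx] [ps s0] pW Wr Wb]]]] := IH _ k' _ nE'.
have WE : ztrans R (W1.1 + W.1) (W1.2 + W.2) = ztrans R W1.1 W1.2 + ztrans R W.1 W.2.
  by rewrite /ztrans !intrD.
exists (x a :: s), (j + p)%N, (W1.1 + W.1, W1.2 + W.2); split => /=.
- split.
    move=> [|i] [|i'] //=; last exact: sep.
    move=> i's p' q'; have [l [/andP[l1 l2] ->]] := sx _ i's.
    rewrite leNgt; apply/negP => h.
    have lE : l = (a + (l - a))%N by lia.
    have : Q (l - a)%N.
      rewrite /Q -lE; apply/andP; split; first by lia.
      by apply/asboolP; exists p', q'.
    by move/jmax; lia.
  move=> [_|i /sx[l [/andP[l1 l2] lE]]].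
    by exists a; split => //; rewrite leqnn/= nE leq_addr.
  by exists l; split => //; lia.
- by split => //; lia.
- by move=> /eqP; rewrite addn_eq0 => /andP[/eqP/W10 -> /eqP/pW ->].
- move=> m; rewrite WE scalerDr.
  (* The isolated 1 is the linking step from [x (a + j)] to the start of the next segment, made once
     whatever [m] is. *)
  have -> : (m * (j + p) + k = (m * j + j) + (1 + (m * p + (k - j.+1))))%N by lia.
  apply: reach_trans (W1r m) _.
  rewrite addrCA [X in reach _ _ _ X]addrC ztransMn; apply: reach_ztrans.
  apply: (reach_trans (reach_segment (a + j) 1)).
  by rewrite addn1 -addnS.
- move=> V hV; rewrite WE.
  have h1 := Wb V hV; have h2 := hV (x (a + j)%N); have h3 := x_jump (a + j)%N.
  have -> : x n - x a - (ztrans R W1.1 W1.2 + ztrans R W.1 W.2) - (size s)%:R *: V =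
      (x n - x (a + j.+1)%N - ztrans R W.1 W.2 - (size s).-1%:R *: V) +
      ((F (x (a + j)%N) - x (a + j)%N - V) - (F (x (a + j)%N) - x (a + j).+1)) +
      (x (a + j)%N - x a - ztrans R W1.1 W1.2).
    rewrite -{1}(prednK s0) -natr1 addnS !scale_pairE; congr pair => /=; ring.
  have t1 := enormD ((x n - x (a + j.+1)%N - ztrans R W.1 W.2 - (size s).-1%:R *: V) +
      ((F (x (a + j)%N) - x (a + j)%N - V) - (F (x (a + j)%N) - x (a + j).+1)))
      (x (a + j)%N - x a - ztrans R W1.1 W1.2).
  have t2 := enormD (x n - x (a + j.+1)%N - ztrans R W.1 W.2 - (size s).-1%:R *: V)
      ((F (x (a + j)%N) - x (a + j)%N - V) - (F (x (a + j)%N) - x (a + j).+1)).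
  have t3 := enormD (F (x (a + j)%N) - x (a + j)%N - V) (- (F (x (a + j)%N) - x (a + j).+1)).
  rewrite enormN in t3.
  rewrite -[(size s).+1%:R]natr1 mulrDl mul1r; lra.
Qed.

End orbit.
End chains.

(** * Deviation from the rotation set *)

Section deviation.
Variable R : realType.
Local Notation P := (R * R)%type.
Variable F : P -> P.
Hypothesis FL : lift_homeo0 F.

Lemma osc_ge (z z' : P) : enorm ((F z - z) - (F z' - z')) <= osc F.
Proof.
apply: sup_upper_bound; last by exists z, z'.
split; first by exists (enorm ((F z - z) - (F z' - z'))), z, z'.
have [B B0 hB] := displacement_bounded FL.
exists (4 * B) => _ [y [y' ->]].
rewrite (le_trans (enorm_le_norm _))//.
have := ler_normB (F y - y) (F y' - y'); have h1 := hB y; have h2 := hB y'; lra.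
Qed.

Lemma osc_ge0 : 0 <= osc F.
Proof. by apply: le_trans (osc_ge 0 0); exact: enorm_ge0. Qed.

Lemma enorm_displacement_iter (n : nat) (z z' : P) :
  enorm (n%:R *: (F z - z) - (iter n F z' - z')) <= n%:R * osc F.
Proof.
elim: n => [|n IH]; first by rewrite scale0r subrr subr0 enorm0 mul0r.
have -> : n.+1%:R *: (F z - z) - (iter n.+1 F z' - z') =
    (n%:R *: (F z - z) - (iter n F z' - z')) +
    ((F z - z) - (F (iter n F z') - iter n F z')).
  by rewrite -natr1 !scale_pairE iterS; congr pair => /=; ring.
by rewrite (le_trans (enormD _ _))// -natr1 mulrDl mul1r lerD// osc_ge.
Qed.

(** [V] is a limit of averages of displacements, each of which is within [osc F] of the displacement
    at [z]. *)
Lemma rot_set_osc (V : P) : rot_set F V -> forall z, enorm (F z - z - V) <= osc F.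
Proof.
move=> [y [n [nty nV]]] z; apply/ler_addgt0Pr => eps eps0.
have [k0 hk0] := nty 1%N.
have e20 : 0 < eps / 2 by rewrite divr_gt0.
have /cvgrPdist_le/(_ _ e20)[k1 _ hk1] := nV.
pose k := maxn k0 k1.
have nk : (0 < n k)%N by apply: hk0; rewrite leq_maxl.
have := hk1 k (leq_maxr _ _) => /=; set u := _ *: _ => Vu.
have nk0 : 0 < (n k)%:R :> R by rewrite ltr0n.
have h1 : enorm (F z - z - u) <= osc F.
  rewrite -(ler_pM2l nk0) -{1}[(n k)%:R]ger0_norm// -enormZ scalerBr /u scalerA.
  by rewrite divff ?gt_eqF// scale1r; exact: enorm_displacement_iter.
have -> : F z - z - V = (F z - z - u) - (V - u) by congr pair => /=; ring.
rewrite (le_trans (enormD _ _))// enormN lerD//.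
by rewrite (le_trans (enorm_le_norm _))//; lra.
Qed.

Lemma dist_set_le (v a : P) (A : set P) : A a -> dist_set v A <= enorm (v - a).
Proof.
move=> Aa; apply: ge_inf; last by exists a.
by exists 0 => _ [b _ <-]; exact: enorm_ge0.
Qed.

Lemma loops_rotation_vector (e : R) (x y : P) (p n : nat) (W : P) : (0 < p)%N ->
  (forall m, reach F e (m * p + n) x (y + m%:R *: W)) ->
  rot_set_eps F e (p%:R^-1 *: W).
Proof.
move=> p0 h; have [z zP] := choice h.
have p0' : 0 < p%:R :> R by rewrite ltr0n.
exists z, (fun m => m * p + n)%N.
have nty : tends_to_infty (fun m => m * p + n)%N.
  move=> M; exists M => m Mm; apply: leq_trans Mm (leq_trans _ (leq_addr _ _)).
  by rewrite leq_pmulr.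
split => //; split; first by move=> k; case: (zP k).
pose b (m : nat) : P := ((m * p + n)%:R / p%:R) *: W.
apply: (@cvg_close _ _ _ b (`|y - x - (n%:R / p%:R) *: W|)) => //.
  move=> m; have [z0 zm _] := zP m; rewrite z0 zm.
  rewrite le_eqVlt; apply/orP; left; apply/eqP; congr (`| _ |).
  rewrite /b natrD natrM !scale_pairE; congr pair => /=; field; by rewrite gt_eqF.
apply: cvg_near_cst; exists 1%N => // m /= m0.
have q0 : 0 < (m * p + n)%:R :> R.
  by rewrite ltr0n addn_gt0 muln_gt0 m0 p0.
by rewrite /b scalerA mulrA mulVf ?gt_eqF// mul1r.
Qed.

(** The [p] looping steps and the [size s - 1] linking steps add up to [n], so [V = W / p] makes the
    decomposition compare with [n V]. Packing bounds [size s], and [d0 + c <= 1] turns the cost of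
    each point into [osc F + 1]. *)
Lemma pseudo_orbit_deviation (x : nat -> P) (d0 c : R) : 0 <= d0 -> 0 < c ->
  c <= 1 -> d0 + c <= 1 -> (forall i, enorm (F (x i) - x i.+1) <= d0) ->
  rot_set_eps F (d0 + c) `<=` rot_set F ->
  forall n, dist_set (x n - x 0%N) (scale_set n (rot_set F)) <=
    4 / (pi * c ^+ 2) * (osc F + 1).
Proof.
move=> d00 c0 c1 dc1 xF sub n.
have [s [p [W [[sep _] [ps s0] pW Wr Wb]]]] :=
  last_return_decomposition FL d00 c0 xF (osc F) (erefl n : n = (0 + n)%N).
have o0 := osc_ge0.
have sbound : (size s)%:R * (c + d0 + osc F) <= 4 / (pi * c ^+ 2) * (osc F + 1).
  by apply: ler_pM; rewrite ?packing//; lra.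
have close V : rot_set F V -> p%:R *: V = ztrans R W.1 W.2 ->
    dist_set (x n - x 0%N) (scale_set n (rot_set F)) <= 4 / (pi * c ^+ 2) * (osc F + 1).
  move=> FV pV; apply: le_trans sbound.
  apply: le_trans (Wb V (rot_set_osc FV)); rewrite -pV.
  have -> : x n - x 0%N - p%:R *: V - (size s).-1%:R *: V = x n - x 0%N - n%:R *: V.
    rewrite -addrA -opprD -scalerDl -natrD; congr (_ - _ *: _); congr (_%:R).
    by apply/eqP; rewrite -eqSS -ps -addnS prednK.
  by apply: dist_set_le; exists V.
(* If [p = 0] then [W = 0], so [p V = W] holds for every rotation vector [V]. *)
have [p0|p0] := posnP p; last first.
  apply: (close (p%:R^-1 *: ztrans R W.1 W.2)).
    by apply: sub; exact: loops_rotation_vector Wr.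
  by rewrite scalerA divff ?scale1r// pnatr_eq0 -lt0n.
have [[V FV]|F0] := pselect (exists V, rot_set F V).
  by apply: (close V) => //; rewrite (pW p0) p0 scale0r.
(* [dist_set] to the empty set is [inf set0 = 0]. *)
rewrite /dist_set (_ : [set _ | _ in _] = set0) ?inf0; last first.
  by apply/seteqP; split=> // r [_ [V FV _] _]; apply: F0; exists V.
by rewrite mulr_ge0 ?addr_ge0// divr_ge0// mulr_ge0 ?pi_ge0// sqr_ge0.
Qed.

End deviation.

(** The square root is the factor that turns the bound [B] for [c1] into exactly [B + eps]. *)
Lemma shrink_radius (R : realType) (c1 K eps : R) : 0 < c1 -> 0 < K -> 0 < eps ->
  exists c, [/\ 0 < c, c < c1 &
    4 / (pi * c ^+ 2) * K <= 4 / (pi * c1 ^+ 2) * K + eps].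
Proof.
move=> c10 K0 eps0; set B := 4 / (pi * c1 ^+ 2) * K.
have B0 : 0 < B by rewrite !mulr_gt0// invr_gt0 mulr_gt0 ?pi_gt0 ?exprn_gt0.
have q0 : 0 < B / (B + eps) by rewrite divr_gt0// addr_gt0.
exists (c1 * Num.sqrt (B / (B + eps))); split.
- by rewrite mulr_gt0// sqrtr_gt0.
- rewrite gtr_pMr// -sqrtr1 ltr_sqrt// ltr_pdivrMr ?addr_gt0// mul1r ltrDl//.
- rewrite exprMn sqr_sqrtr ?(ltW q0)// le_eqVlt; apply/orP; left; apply/eqP.
  have pc : pi * c1 ^+ 2 != 0 :> R by rewrite gt_eqF// mulr_gt0 ?pi_gt0 ?exprn_gt0.
  rewrite mulrA invfM mulrA mulrAC -/B invf_div mulrCA divff ?mulr1// gt_eqF//.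
Qed.

Theorem theorem3p2 (R : realType) (area : bool) (F : R * R -> R * R) (eps : R) :
  in_H area F -> 0 < eps < 1 -> upper_stable area F eps ->
  rot_set_eps F (eps / 2) = rot_set F /\
  (forall x : nat -> R * R, (forall i : nat, enorm (F (x i) - x i.+1) < eps / 2) ->
     forall n : nat, dist_set (x n - x 0%N) (scale_set n (rot_set F))
       <= 16 / (pi * eps ^+ 2) * (osc F + 2) + eps) /\
  (forall x : nat -> R * R, (forall i : nat, x i.+1 = F (x i)) ->
     forall n : nat, dist_set (x n - x 0%N) (scale_set n (rot_set F))
       <= 4 / (pi * eps ^+ 2) * (osc F + 1) + eps).
Proof.
move=> FH /andP[e0 e1] Fst; have FL : lift_homeo0 F by case: FH.
have o0 := osc_ge0 FL.
have sub e : 0 < e -> e < eps -> rot_set_eps F e `<=` rot_set F.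
  exact: rot_set_eps_sub FH Fst.
have e20 : 0 < eps / 2 by rewrite divr_gt0.
split; [|split].
- apply/seteqP; split; first by apply: sub => //; lra.
  move=> v [z [n [nty nv]]].
  exists (fun k i => iter i F (z k)), n; split => //; split => // k i _.
  by rewrite iterS subrr enorm0.
(* With jumps up to [eps / 2], the gap [c] has to stay below [eps / 2]; squaring this half gives 16
   = 4 * 4. *)
- move=> x xF n.
  have [c [c0 cc h]] := @shrink_radius R (eps / 2) (osc F + 2) eps e20
    (ltr_wpDl o0 (ltr0n R 2)) e0.
  have -> : 16 / (pi * eps ^+ 2) = 4 / (pi * (eps / 2) ^+ 2).
    have pi_neq0 : pi != 0 :> R by rewrite gt_eqF ?pi_gt0.
    have eps_neq0 : eps != 0 by rewrite gt_eqF.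
    by move: (pi : R) pi_neq0 => q q0; field; rewrite eps_neq0.
  apply: le_trans h; apply: (@le_trans _ _ (4 / (pi * c ^+ 2) * (osc F + 1))).
    apply: (pseudo_orbit_deviation FL (ltW e20) c0 _ _ (fun i => ltW (xF i))).
    + by lra.
    + by lra.
    + by apply: sub; lra.
  rewrite ler_wpM2l ?lerD2l ?ler1n// divr_ge0// mulr_ge0 ?pi_ge0 ?sqr_ge0//.
(* An orbit has jumps of size 0, so the gap may approach [eps] itself. *)
- move=> x xF n.
  have [c [c0 cc h]] := @shrink_radius R eps (osc F + 1) eps e0
    (ltr_wpDl o0 ltr01) e0.
  have xF0 i : enorm (F (x i) - x i.+1) <= 0 by rewrite xF subrr enorm0.
  apply: le_trans h; apply: (pseudo_orbit_deviation FL (lexx 0) c0 _ _ xF0).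
  + by lra.
  + by lra.
  + by apply: sub; lra.
Qed.
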